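(* Inside the $9$-dimensional projective space $\mathbb{P}(\mathrm{Sym}^2(\mathbb{C}^4)^\vee)$ of quadratic surfaces in $\mathbb{P}^3=\mathbb{P}^3_{\mathbb{C}}$, let $H$ be the Zariski closure of the set of quadratic surfaces $W$ of the form $W = L \star R$ with $L,R\subset\mathbb{P}^3$ lines. Then $H$ has dimension $5$, and $H$ coincides with the Zariski closure of the set of quadrics $\{x^{T}Ax=0\}$ where $A$ is a nonsingular symmetric $4\times 4$ complex matrix whose inverse $A^{-1}$ has all diagonal entries equal to $0$.
   Context: Work over $\mathbb{C}$ with fixed homogeneous coordinates $x_0,\dots,x_3$ on $\mathbb{P}^3$. For points $p=(p_0:\cdots:p_3)$ and $q=(q_0:\cdots:q_3)$ the Hadamard product is $p\star q=(p_0q_0:\cdots:p_3q_3)$, defined whenever not all $p_iq_i$ vanish. For varieties $X,Y\subset\mathbb{P}^3$, $X\star Y$ is the Zariski closure of $\{p\star q : p\in X,\ q\in Y,\ p\star q \text{ is defined}\}$. A quadratic surface is a hypersurface of degree $2$ in $\mathbb{P}^3$; a quadric given by $x^TAx=0$ with $A$ symmetric corresponds to the class of $A$ up to nonzero scalars. *)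

(* Defs.v *)
From HB Require Import structures.
From mathcomp Require Import all_boot all_order all_algebra.
From mathcomp Require Import classical_sets reals.
From mathcomp Require Import complex.
From mathcomp Require Import mpoly.

Set Implicit Arguments.
Unset Strict Implicit.
Unset Printing Implicit Defensive.

Import GRing.Theory.
Local Open Scope ring_scope.
Local Open Scope classical_set_scope.

(* The projective space P(V): its points are the one-dimensional subspaces of
   V. In particular proj 'rV[K]_n.+1 is P^n, with (u_0 : ... : u_n) = <[u]>.  *)
Definition proj (K : fieldType) (V : vectType K) : Type :=
  {p : {vspace V} | \dim p == 1%N}.

Section Zariski.
Variables (K : fieldType) (V : vectType K).
Implicit Types (F : V -> K) (p : proj V) (S Z : set (proj V)).

(* Homogeneous polynomial functions of degree d on V, without a choice of
   basis: homogeneous polynomials of degree d in linear forms on V.           *)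
Definition hom_polyfun (d : nat) F : Prop :=
  exists (m : nat) (x : 'I_m -> 'Hom(V, K^o)) (f : {mpoly K[m]}),
    f \is d.-homog /\ forall v, F v = f.@[fun i => x i v].

Definition vanishes_at F p : Prop := forall v, v \in val p -> F v = 0.

Definition zero_locus (E : set (V -> K)) : set (proj V) :=
  [set p | forall F, E F -> vanishes_at F p].

Definition zclosed Z : Prop :=
  exists E : set (V -> K),
    (forall F, E F -> exists d, hom_polyfun d F) /\ Z = zero_locus E.

Definition zclosure S : set (proj V) := smallest zclosed S.

Definition zirreducible Z : Prop :=
  Z !=set0 /\
  forall Z1 Z2, zclosed Z1 -> zclosed Z2 ->
    Z `<=` Z1 `|` Z2 -> Z `<=` Z1 \/ Z `<=` Z2.

(* c 0, ..., c d is a strictly increasing chain of irreducible closed sets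
   contained in Z.                                                            *)
Definition irr_chain Z (d : nat) (c : nat -> set (proj V)) : Prop :=
  (forall i, (i <= d)%N -> [/\ zclosed (c i), zirreducible (c i) & c i `<=` Z])
  /\ (forall i, (i < d)%N -> c i `<` c i.+1).

(* Krull dimension. As the members of a chain are closed in P(V), and not only
   in Z, this is the dimension of Z only when Z is closed.                    *)
Definition zdim_eq Z (d : nat) : Prop :=
  (exists c, irr_chain Z d c) /\
  (forall e c, irr_chain Z e c -> (e <= d)%N).

End Zariski.

Section Hadamard.
Variables (K : fieldType) (n : nat).
Implicit Types (u v : 'rV[K]_n) (p q r : proj 'rV[K]_n).
Implicit Types (X Y W : set (proj 'rV[K]_n)).

Definition hmul u v : 'rV[K]_n := \row_i (u 0 i * v 0 i).

(* r is p * q. As r is one-dimensional, this entails hmul u v != 0, that is,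
   that p * q is defined.                                                     *)
Definition is_hadamard p q r : Prop :=
  exists u v, [/\ val p = <[u]>%VS, val q = <[v]>%VS & val r = <[hmul u v]>%VS].

Definition hadamard_prod X Y : set (proj 'rV[K]_n) :=
  zclosure [set r | exists p q, [/\ X p, Y q & is_hadamard p q r]].

Definition is_line X : Prop :=
  exists U : {vspace 'rV[K]_n}, \dim U = 2 /\ X = [set p | (val p <= U)%VS].

Definition mpoly_fun (f : {mpoly K[n]}) : 'rV[K]_n -> K := fun x => f.@[x 0].

(* W is the hypersurface with equation f, and f is an equation of minimal
   degree: f generates the homogeneous ideal of W. Hence the degree of the
   hypersurface W is that of f; a plane, for instance, is not a hypersurface of
   degree 2, although it is the zero locus of the square of a linear form.    *)
Definition hypersurface_of (f : {mpoly K[n]}) W : Prop :=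
  W = [set p | vanishes_at (mpoly_fun f) p] /\
  forall (e : nat) (g : {mpoly K[n]}), g \is e.-homog ->
    (forall p, W p -> vanishes_at (mpoly_fun g) p) <-> (exists h, g = f * h).

End Hadamard.

Section Quadrics.
Variable K : fieldType.

(* The quadratic surfaces in P^3, as classes of quadratic forms. *)
Definition quadric : Type := proj (dhomog 4 K 2).

Definition hadamard_quadrics : set quadric :=
  [set w | exists (q : dhomog 4 K 2) (L R : set (proj 'rV[K]_4)),
     [/\ val w = <[q]>%VS, is_line L, is_line R
       & hypersurface_of q (hadamard_prod L R)]].

Definition has_matrix (w : quadric) (A : 'M[K]_4) : Prop :=
  exists q : dhomog 4 K 2, val w = <[q]>%VS /\
    forall x : 'rV[K]_4, mpoly_fun q x = (x *m A *m x^T) 0 0.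

Definition zero_diag_inverse_quadrics : set quadric :=
  [set w | exists A : 'M[K]_4,
     [/\ A^T = A, A \in unitmx, forall i, invmx A i i = 0 & has_matrix w A]].

End Quadrics.

Arguments hadamard_quadrics : clear implicits.
Arguments zero_diag_inverse_quadrics : clear implicits.

(* Main.v *)
(* A pair of lines gives four rank one tensors l_i (x) r_i in C^2 (x) C^2, the
   rows of a matrix M, and their Hadamard product is the image of the Segre
   quadric z_0 z_3 = z_1 z_2, with polar form D, under z |-> z M^T.  It is a
   quadric iff M is invertible, with matrix A such that A^-1 = M D M^T up to a
   scalar.  The rows of M being of rank one, hence isotropic for D, A^-1 has zero
   diagonal; conversely A^-1 = M D M^T for some M as the field is closed, and
   zero diagonal means that the rows of M have rank one.  Thus the two sets of
   quadrics agree even before taking closures.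

   They are parametrised by B |-> adj B on the 6-dimensional space of symmetric
   matrices B with zero diagonal.  Images of a flag of subspaces give a chain of
   length 5.  In a chain c_0 < ... < c_6, forms f_i of the same degree D vanishing
   on c_(i-1) but not on c_i would be algebraically independent on c_6; pulled
   back to forms of degree 3D in 6 variables, their monomials of degree 6N
   outnumber, for large N, the dimension of the forms of degree 18DN. *)
Require Import Defs.
From HB Require Import structures.
From mathcomp Require Import all_boot all_order all_algebra.
From mathcomp Require Import classical_sets reals.
From mathcomp Require Import complex.
From mathcomp Require Import mpoly.
From mathcomp Require Import perm ring.

Set Implicit Arguments.
Unset Strict Implicit.
Unset Printing Implicit Defensive.

Import Order.TTheory GRing.Theory Num.Theory.
Local Open Scope ring_scope.
Local Open Scope classical_set_scope.

(** * Polynomials and their values *)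

Section LastVariable.
Variables (n : nat) (K : comNzRingType).
Implicit Types (p : {mpoly K[n.+1]}) (P : {poly {mpoly K[n]}}).
Local Notation widen := (widen_ord (leqnSn n)).

(** Inverse of [muni], the expansion in powers of the last variable. It carries univariate
    arguments, such as division by a monic polynomial, back to several variables. *)
Definition muni_inv P : {mpoly K[n.+1]} := (map_poly (@mwiden n K) P).['X_ord_max].

Lemma muni_invM : {morph muni_inv : P Q / P * Q}.
Proof. by move=> P Q; rewrite /muni_inv rmorphM hornerM. Qed.

Lemma muni_invD : {morph muni_inv : P Q / P + Q}.
Proof. by move=> P Q; rewrite /muni_inv rmorphD hornerD. Qed.

Lemma muniK : cancel (@muni n K) muni_inv.
Proof.
move=> p; rewrite [RHS]mpolyE muniE /muni_inv rmorph_sum horner_sum.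
apply: eq_bigr => m _ /=.
rewrite map_polyZ /= map_polyXn hornerZ hornerXn mwidenZ mwidenX -scalerAl.
congr (_ *: _); rewrite mpolyXn -mpolyXD; congr 'X_[_].
apply/mnmP => i; rewrite mnmDE mulmnE mnm1E.
case: (unliftP ord_max i) => [j|] ->.
  rewrite -(_ : widen j = lift ord_max j); last first.
    by apply/val_inj; rewrite /= /bump leqNgt ltn_ord.
  by rewrite mnmwiden_widen mnmE -val_eqE /= gtn_eqF //= addn0.
by rewrite mnmwiden_ordmax eqxx mul1n.
Qed.

Lemma meval_mwiden (v : 'I_n.+1 -> K) (p : {mpoly K[n]}) :
  (mwiden p).@[v] = p.@[v \o widen].
Proof.
elim/mpolyind: p => [|c m p _ _ IHp]; first by rewrite mwiden0 !meval0.
rewrite mwidenD !mevalD IHp mwidenZ !mevalZ mwidenX !mevalX big_ord_recr /=.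
rewrite mnmwiden_ordmax expr0 mulr1.
by under eq_bigr do rewrite mnmwiden_widen.
Qed.

Lemma meval_muni_inv (v : 'I_n.+1 -> K) P :
  (muni_inv P).@[v] = (map_poly (meval (v \o widen)) P).[v ord_max].
Proof.
rewrite /muni_inv -horner_map /= mevalXU -map_poly_comp; congr _.[_].
by apply: eq_map_poly => p /=; rewrite meval_mwiden.
Qed.

Lemma meval_muni (v : 'I_n.+1 -> K) p :
  p.@[v] = (map_poly (meval (v \o widen)) (muni p)).[v ord_max].
Proof. by rewrite -{1}[p]muniK meval_muni_inv. Qed.

End LastVariable.

Lemma poly_eq0_horner (K : numDomainType) (p : {poly K}) :
  (forall x, p.[x] = 0) -> p = 0.
Proof.
move=> p0; apply/eqP; apply: contraT => nz_p.
pose s : seq K := [seq i%:R | i <- iota 0 (size p)].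
have := max_poly_roots nz_p (rs := s); rewrite size_map size_iota ltnn.
apply; first by apply/allP => x _; rewrite /root p0.
by rewrite map_inj_uniq ?iota_uniq // => i j /eqP; rewrite eqr_nat => /eqP.
Qed.

Lemma poly_neq0_horner (K : numDomainType) (p : {poly K}) :
  p != 0 -> exists x, p.[x] != 0.
Proof.
move=> nz_p; apply: boolp.contrapT => no_x; case/eqP: nz_p.
apply: poly_eq0_horner => x; apply/eqP; apply: contraT => px.
by case: no_x; exists x.
Qed.

(** Induction on the number of variables: with the first [n] fixed, the polynomial in the last one
    vanishes everywhere, so each coefficient of [muni p] vanishes at every point. *)
Lemma mpoly_eq0_meval (K : numDomainType) n (p : {mpoly K[n]}) :
  (forall v, p.@[v] = 0) -> p = 0.
Proof.
elim: n p => [|n IHn] p p0.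
  rewrite [p]nvar0_mpolyC; have := p0 (fun _ => 0).
  by rewrite [p in p.@[_]]nvar0_mpolyC mevalC => ->; rewrite mpolyC0.
rewrite -[p]muniK; suff -> : muni p = 0 by rewrite /muni_inv rmorph0 horner0.
apply/polyP => k; rewrite coef0; apply: IHn => v.
have : map_poly (meval v) (muni p) = 0.
  apply: poly_eq0_horner => x.
  pose w i := if unlift ord_max i is Some j then v j else x.
  have := p0 w; rewrite meval_muni {2}/w unlift_none.
  rewrite (eq_map_poly (g := meval v)) // => q; apply: meval_eq => i /=.
  have -> : widen_ord (leqnSn n) i = lift ord_max i.
    by apply/val_inj; rewrite /= /bump leqNgt ltn_ord.
  by rewrite /w liftK.
by move=> /(congr1 (fun q : {poly K} => q`_k)); rewrite coef_map coef0.
Qed.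

Lemma mpoly_eq_meval (K : numDomainType) n (p q : {mpoly K[n]}) :
  (forall v, p.@[v] = q.@[v]) -> p = q.
Proof.
move=> pq; apply/eqP; rewrite -subr_eq0; apply/eqP/mpoly_eq0_meval => v.
by rewrite mevalB pq subrr.
Qed.

(* Division by 'X_n ^+ 2 + Q leaves a remainder a 'X_n + b; at a point of the
   hypersurface both square roots of - Q are allowed, whence b = 0 and a Q = 0. *)
Lemma dvd_of_vanishing_square (K : numClosedFieldType) n (Q : {mpoly K[n]})
    (g : {mpoly K[n.+1]}) : Q != 0 ->
  (forall v, (mwiden Q + 'X_ord_max ^+ 2).@[v] = 0 -> g.@[v] = 0) ->
  exists h, g = (mwiden Q + 'X_ord_max ^+ 2) * h.
Proof.
move=> nzQ g0; set q := _ + _ in g0 *.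
pose d : {poly {mpoly K[n]}} := 'X ^+ 2 + Q%:P.
have sz_d : size d = 3%N by rewrite size_polyDl size_polyXn // size_polyC nzQ.
have mon_d : d \is monic.
  by rewrite monicE /lead_coef sz_d coefD coefXn coefC addr0.
have uni_d : muni_inv d = q.
  rewrite /muni_inv /d rmorphD /= map_polyXn map_polyC hornerD hornerXn hornerC.
  by rewrite addrC.
have := Pdiv.RingMonic.rdivp_eq mon_d (muni g).
set h := Pdiv.Ring.rdivp _ _; set r := Pdiv.Ring.rmodp _ _ => g_eq.
have sz_r : (size r <= 2)%N.
  by rewrite -ltnS -sz_d Pdiv.Ring.ltn_rmodpN0 ?monic_neq0.
suff r0 : r = 0.
  exists (muni_inv h); rewrite -[g]muniK g_eq r0 addr0 muni_invM uni_d.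
  by rewrite mulrC.
have rE : r = r`_1 *: 'X + (r`_0)%:P.
  apply/polyP => -[|[|k]]; rewrite coefD coefZ coefX coefC /=.
  - by rewrite mulr0 add0r.
  - by rewrite mulr1 addr0.
  - by rewrite mulr0 add0r nth_default // (leq_trans sz_r).
have rv (v : 'I_n -> K) (x : K) : x ^+ 2 = - Q.@[v] ->
    (r`_1).@[v] * x + (r`_0).@[v] = 0.
  move=> x2; pose w i := if unlift ord_max i is Some j then v j else x.
  have wv : w \o widen_ord (leqnSn n) =1 v.
    move=> i /=; have -> : widen_ord (leqnSn n) i = lift ord_max i.
      by apply/val_inj; rewrite /= /bump leqNgt ltn_ord.
    by rewrite /w liftK.
  have wvE p := meval_eq p wv.
  have wx : w ord_max = x by rewrite /w unlift_none.
  have qw : q.@[w] = 0.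
    by rewrite mevalD meval_mwiden wvE rmorphXn /= mevalXU wx x2 subrr.
  have := g0 _ qw; rewrite -[g]muniK g_eq muni_invD muni_invM uni_d mevalD mevalM qw.
  rewrite mulr0 add0r meval_muni_inv wx {1}rE rmorphD /= map_polyZ map_polyX.
  by rewrite map_polyC hornerD hornerZ hornerX hornerC /= !wvE.
have rw (v : 'I_n -> K) : (r`_1).@[v] * sqrtC (- Q.@[v]) = 0 /\ (r`_0).@[v] = 0.
  have e1 := rv v _ (sqrtCK _); have := rv v (- sqrtC (- Q.@[v])).
  rewrite sqrrN sqrtCK => /(_ erefl) e2.
  have : (r`_0).@[v] *+ 2 = 0.
    by rewrite -[RHS]addr0 -{1}e1 -{1}e2; ring.
  move/eqP; rewrite mulrn_eq0 /= => /eqP b0.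
  by split=> //; move: e1; rewrite b0 addr0.
have r00 : r`_0 = 0 by apply: mpoly_eq0_meval => v; case: (rw v).
have : r`_1 * Q = 0.
  apply: mpoly_eq0_meval => v; case: (rw v) => /eqP + _.
  rewrite mulf_eq0 sqrtC_eq0 oppr_eq0 mevalM => /orP[]/eqP->;
  by rewrite ?mul0r ?mulr0.
move/eqP; rewrite mulf_eq0 (negPf nzQ) orbF => /eqP r10.
by rewrite rE r10 r00 scale0r add0r polyC0.
Qed.

(** * Homogeneous functions and the Zariski topology *)

Section Homogeneity.
Variable K : comNzRingType.

Lemma dhomog_bigprod n (I : Type) (r : seq I) (F : I -> {mpoly K[n]})
    (d : I -> nat) : (forall i, F i \is (d i).-homog) ->
  \prod_(i <- r) F i \is (\sum_(i <- r) d i).-homog.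
Proof.
move=> Fd; elim: r => [|i r IHr]; first by rewrite !big_nil dhomog1.
by rewrite !big_cons dhomogM.
Qed.

Lemma dhomog_comp_mpoly n k (p : {mpoly K[n]}) (lq : n.-tuple {mpoly K[k]}) e d :
    p \is d.-homog -> (forall i, tnth lq i \is e.-homog) ->
  p \mPo lq \is (e * d).-homog.
Proof.
move=> /dhomogP pd lqa; rewrite comp_mpolyE big_seq rpred_sum // => m /pd <-.
rewrite rpredZ //= mdegE big_distrr; apply: dhomog_bigprod => i.
exact: dhomogMn.
Qed.

Lemma meval_dhomogZ n d (p : {mpoly K[n]}) c (v : 'I_n -> K) :
  p \is d.-homog -> p.@[fun i => c * v i] = c ^+ d * p.@[v].
Proof.
move=> /dhomogP pd; rewrite !mevalE big_distrr [LHS]big_seq [RHS]big_seq.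
apply: eq_bigr => m /pd <- /=; rewrite mulrCA; congr (_ * _).
rewrite mdegE -prodrXr -big_split; apply: eq_bigr => i _.
by rewrite exprMn.
Qed.

End Homogeneity.

Section HomPolyFun.
Variables (K : fieldType) (V : vectType K).
Implicit Types (F G : V -> K) (d e : nat) (v : V).
Local Notation b := (vbasis {:V}).

(** The linear forms in the definition vary with the function. Expressing them in a fixed basis
    gives all functions the same variables, so that they can be added and multiplied. *)
Lemma hom_polyfunP d F : hom_polyfun d F <->
  exists2 f : {mpoly K[\dim {:V}]},
    f \is d.-homog & forall v, F v = f.@[fun i => coord b i v].
Proof.
split=> [[m] [x] [f] [fd Ff]|[f fd Ff]]; last first.
  exists (\dim {:V}), (fun i => linfun (coord b i : V -> K^o)), f; split=> // v.
  by rewrite Ff; apply: meval_eq => i; rewrite lfunE.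
pose l : m.-tuple {mpoly K[\dim {:V}]} :=
  [tuple \sum_(j < \dim {:V}) (x i b`_j : K) *: 'X_j | i < m].
exists (f \mPo l) => [|v].
  rewrite -[d]mul1n; apply: dhomog_comp_mpoly => // i.
  rewrite tnth_mktuple rpred_sum // => j _; rewrite rpredZ // dhomogX.
  by rewrite /= mdeg1.
rewrite Ff comp_mpoly_meval; apply: meval_eq => i; rewrite tnth_mktuple.
rewrite {1}(coord_vbasis (memvf v)) !raddf_sum /=; apply: eq_bigr => j _.
by rewrite linearZ /= mevalZ mevalXU [RHS]mulrC.
Qed.

Lemma eq_hom_polyfun d F G : F =1 G -> hom_polyfun d F -> hom_polyfun d G.
Proof.
by move=> FG [m] [x] [f] [fd Ff]; exists m, x, f; split=> // v; rewrite -FG.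
Qed.

Lemma linfun_exists (F : V -> K) : (forall c u v, F (c *: u + v) = c * F u + F v) ->
  exists x : 'Hom(V, K^o), forall v, x v = F v.
Proof.
move=> F_lin.
pose Fl : {linear V -> K^o} := HB.pack (F : V -> K^o)
  (GRing.isLinear.Build _ _ _ _ (F : V -> K^o) F_lin).
by exists (linfun Fl) => v; rewrite lfunE.
Qed.

Lemma hom_polyfun_meval n d (x : 'I_n -> V -> K) (f : {mpoly K[n]}) :
    f \is d.-homog -> (forall i c u v, x i (c *: u + v) = c * x i u + x i v) ->
  hom_polyfun d (fun v => f.@[x^~ v]).
Proof.
move=> fd x_lin.
have /boolp.choice[y yx] i : exists y : 'Hom(V, K^o), forall v, y v = x i v.
  exact/linfun_exists.
by exists n, y, f; split=> // v; apply: meval_eq => i; rewrite yx.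
Qed.

Lemma hom_polyfun_linear F :
  (forall c u v, F (c *: u + v) = c * F u + F v) -> hom_polyfun 1 F.
Proof.
move=> /linfun_exists[x xF].
exists 1%N, (fun=> x), 'X_ord0; split; first by rewrite dhomogX /= mdeg1.
by move=> v; rewrite mevalXU xF.
Qed.

Lemma hom_polyfun_cst c : hom_polyfun 0 (fun _ : V => c).
Proof.
apply/hom_polyfunP; exists c%:MP => [|v]; last by rewrite mevalC.
by rewrite -[c]mulr1 -alg_mpolyC -scalerA scale1r rpredZ // dhomog1.
Qed.

Lemma hom_polyfunM d e F G : hom_polyfun d F -> hom_polyfun e G ->
  hom_polyfun (d + e) (fun v => F v * G v).
Proof.
move=> /hom_polyfunP[f fd Ff] /hom_polyfunP[g ge Gg]; apply/hom_polyfunP.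
by exists (f * g) => [|v]; rewrite ?dhomogM // mevalM Ff Gg.
Qed.

Lemma hom_polyfunX d k F : hom_polyfun d F ->
  hom_polyfun (d * k) (fun v => F v ^+ k).
Proof.
move=> /hom_polyfunP[f fd Ff]; apply/hom_polyfunP.
by exists (f ^+ k) => [|v]; rewrite ?dhomogMn // rmorphXn /= Ff.
Qed.

Lemma hom_polyfunZ d c F : hom_polyfun d F -> hom_polyfun d (fun v => c * F v).
Proof. by move=> Fd; apply: (hom_polyfunM (hom_polyfun_cst c) Fd). Qed.

Lemma hom_polyfun_sum d (I : Type) (r : seq I) (P : pred I) (F : I -> V -> K) :
  (forall i, P i -> hom_polyfun d (F i)) ->
  hom_polyfun d (fun v => \sum_(i <- r | P i) F i v).
Proof.
move=> Fd; elim: r => [|i r /hom_polyfunP[f fd Ff]].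
  by apply/hom_polyfunP; exists 0 => [|v]; rewrite ?rpred0 // big_nil meval0.
have [Pi|nPi] := boolP (P i); last first.
  apply/hom_polyfunP; exists f => // v.
  by rewrite big_cons (negPf nPi) Ff.
have /hom_polyfunP[g gd Fg] := Fd i Pi; apply/hom_polyfunP.
by exists (g + f) => [|v]; rewrite ?rpredD // big_cons Pi mevalD Ff Fg.
Qed.

Lemma hom_polyfun_prod (I : Type) (r : seq I) (d : I -> nat) (F : I -> V -> K) :
  (forall i, hom_polyfun (d i) (F i)) ->
  hom_polyfun (\sum_(i <- r) d i) (fun v => \prod_(i <- r) F i v).
Proof.
move=> Fd; elim: r => [|i r IHr].
  rewrite big_nil; apply: eq_hom_polyfun (hom_polyfun_cst 1) => v.
  by rewrite big_nil.
rewrite big_cons; apply: eq_hom_polyfun (hom_polyfunM (Fd i) IHr) => v.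
by rewrite big_cons.
Qed.

Lemma hom_polyfun_det n d (A : V -> 'M[K]_n) :
  (forall i j, hom_polyfun d (fun v => A v i j)) ->
  hom_polyfun (d * n) (fun v => \det (A v)).
Proof.
move=> Ad; apply: hom_polyfun_sum => s _; apply: hom_polyfunZ.
have := hom_polyfun_prod (index_enum 'I_n) (fun i => Ad i (s i)).
by rewrite sum_nat_const card_ord mulnC.
Qed.

Lemma hom_polyfun_homog d F c v :
  hom_polyfun d F -> F (c *: v) = c ^+ d * F v.
Proof.
move=> [m] [x] [f] [fd Ff]; rewrite !Ff -meval_dhomogZ //.
by apply: meval_eq => i; rewrite linearZ.
Qed.

End HomPolyFun.

Section Points.
Variables (K : fieldType) (V : vectType K).
Implicit Types (p : proj V) (S Z : set (proj V)) (v : V).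

Lemma proj_point v : v != 0 -> exists p : proj V, val p = <[v]>%VS.
Proof.
move=> nz_v; have v1 : \dim <[v]> == 1%N by rewrite dim_vline nz_v.
by exists (exist _ <[v]>%VS v1).
Qed.

Lemma proj_line p : exists2 v, v != 0 & val p = <[v]>%VS.
Proof.
case: p => U /= U1; exists (vpick U).
  by rewrite vpick0 -dimv_eq0 (eqP U1).
apply/esym/eqP; rewrite eqEdim -memvE memv_pick dim_vline vpick0 (eqP U1).
by rewrite -dimv_eq0 (eqP U1).
Qed.

Lemma vline_eq (u v : V) : <[u]>%VS = <[v]>%VS -> exists c, u = c *: v.
Proof. by move=> uv; apply/vlineP; rewrite -uv memv_line. Qed.

Lemma vlineZ c v : c != 0 -> <[c *: v]>%VS = <[v]>%VS.
Proof.
move=> nz_c; apply/eqP; rewrite eqEsubv -!memvE memvZ ?memv_line //=.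
by rewrite -[v in v \in _](scalerK nz_c) memvZ ?memv_line.
Qed.

Lemma vanishes_atE d (F : V -> K) p v : hom_polyfun d F ->
  val p = <[v]>%VS -> vanishes_at F p <-> F v = 0.
Proof.
move=> Fd pv; split=> [|Fv0 w]; first by apply; rewrite pv memv_line.
by rewrite pv => /vlineP[c ->]; rewrite (hom_polyfun_homog _ _ Fd) Fv0 mulr0.
Qed.

Lemma zclosed_vanishes d F : hom_polyfun d F ->
  zclosed [set p : proj V | vanishes_at F p].
Proof.
move=> Fd; exists [set F]; split=> [_ ->|]; first by exists d.
by apply/seteqP; split=> p /= pF; [move=> _ -> | apply: pF].
Qed.

Lemma sub_zclosure S : S `<=` zclosure S.
Proof. exact: sub_smallest. Qed.

Lemma zclosure_min S Z : zclosed Z -> S `<=` Z -> zclosure S `<=` Z.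
Proof. by move=> Zc SZ; apply: smallest_sub. Qed.

Lemma zclosure_vanishes d F S : hom_polyfun d F ->
  (forall p, S p -> vanishes_at F p) -> forall p, zclosure S p -> vanishes_at F p.
Proof. by move=> Fd SF; apply: zclosure_min (zclosed_vanishes Fd) SF. Qed.

(** The closure is cut out by all homogeneous functions that vanish on [S]. *)
Lemma zclosed_zclosure S : zclosed (zclosure S).
Proof.
exists [set F | (exists d, hom_polyfun d F) /\ forall p, S p -> vanishes_at F p].
split=> [F [] //|]; apply/seteqP.
split=> [p Sp F [[d Fd] SF]|p pE Z [[E [Ehom ->]] SZ] F EF].
  exact: zclosure_vanishes Fd SF p Sp.
by apply: pE; split=> [|q Sq]; [exact: Ehom | exact: SZ].
Qed.

Lemma zclosure_mono S1 S2 : S1 `<=` S2 -> zclosure S1 `<=` zclosure S2.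
Proof.
move=> S12; apply: zclosure_min; first exact: zclosed_zclosure.
exact: subset_trans S12 (@sub_zclosure S2).
Qed.

Lemma zclosed_separation Z p : zclosed Z -> ~ Z p ->
  exists d F, [/\ hom_polyfun d F, forall q, Z q -> vanishes_at F q
                & ~ vanishes_at F p].
Proof.
move=> [E [Ehom ->]] /boolp.existsNP[F] /boolp.not_implyP[EF Fp].
by have [d Fd] := Ehom F EF; exists d, F; split=> // q; apply.
Qed.

End Points.

Lemma hom_polyfun_mpoly_fun (K : fieldType) n d (f : {mpoly K[n]}) :
  f \is d.-homog -> hom_polyfun d (mpoly_fun f).
Proof.
move=> fd; apply: (@hom_polyfun_meval _ 'rV[K]_n n d (fun i v => v 0 i)) => //.
by move=> i c u v; rewrite !mxE.
Qed.

(** * Quadratic forms *)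

Section QuadraticForm.
Variables (K : comNzRingType) (n : nat).
Implicit Types (A B : 'M[K]_n) (x : 'rV[K]_n).

Definition qform A : {mpoly K[n]} := \sum_i \sum_j A i j *: ('X_i * 'X_j).

Lemma qform_homog A : qform A \is 2.-homog.
Proof.
rewrite rpred_sum // => i _; rewrite rpred_sum // => j _; rewrite rpredZ //.
by rewrite (@dhomogM _ _ _ 1 _ 1) // dhomogX /= mdeg1.
Qed.

Lemma meval_qform A x : (qform A).@[x 0] = (x *m A *m x^T) 0 0.
Proof.
rewrite mxE; under [RHS]eq_bigr do rewrite !mxE mulr_suml.
rewrite exchange_big raddf_sum; apply: eq_bigr => i _ /=.
rewrite raddf_sum; apply: eq_bigr => j _ /=.
by rewrite mevalZ mevalM !mevalXU; ring.
Qed.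

End QuadraticForm.

Definition linear_subst (K : comNzRingType) m n (M : 'M[K]_(m, n)) :
  n.-tuple {mpoly K[m]} := [tuple \sum_i M i j *: 'X_i | j < n].

Lemma meval_linear_subst (K : comNzRingType) m n (M : 'M[K]_(m, n))
    (g : {mpoly K[n]}) (x : 'rV[K]_m) :
  (g \mPo linear_subst M).@[x 0] = g.@[(x *m M) 0].
Proof.
rewrite comp_mpoly_meval; apply: meval_eq => j; rewrite tnth_mktuple.
rewrite raddf_sum mxE; apply: eq_bigr => i _ /=.
by rewrite mevalZ mevalXU mulrC.
Qed.

Lemma mpoly_eq_rV (K : numDomainType) n (p q : {mpoly K[n]}) :
  (forall x : 'rV[K]_n, p.@[x 0] = q.@[x 0]) -> p = q.
Proof.
move=> pq; apply: mpoly_eq_meval => v.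
have vE : (\row_i v i) 0 =1 v by move=> i; rewrite mxE.
by have := pq (\row_i v i); rewrite !(meval_eq _ vE).
Qed.

(** First step of diagonalisation by congruence. If S_00 = 0 and S_0j is nonzero, adding [c] times
    row and column [j] turns the corner into 2 c S_0j + c^2 S_jj, which cannot vanish for both c = 1
    and c = -1: the two values differ by 4 S_0j. *)
Lemma sym_pivot (K : numFieldType) n (S : 'M[K]_n.+1) : S^T = S ->
  exists2 E : 'M[K]_n.+1, E \in unitmx &
    (E *m S *m E^T) 0 0 != 0 \/ (forall j, (E *m S *m E^T) 0 j = 0).
Proof.
move=> symS; have [S0|/forallPn[j S0j]] := boolP [forall j, S 0 j == 0].
  exists 1%:M; first exact: unitmx1.
  by right=> j; rewrite mul1mx trmx1 mulmx1; apply/eqP/(forallP S0).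
have [S00|S00] := eqVneq (S 0 0) 0; last first.
  by exists 1%:M; [exact: unitmx1 | left; rewrite mul1mx trmx1 mulmx1].
have nz_j : j != 0 by apply: contraNneq S0j => ->; rewrite S00.
pose E c : 'M[K]_n.+1 := 1%:M + c *: delta_mx 0 j.
have unitE c : E c \in unitmx.
  apply: (@proj1 _ (E (- c) \in unitmx)); apply: mulmx1_unit.
  rewrite /E mulmxDl mul1mx mulmxDr mulmx1 -scalemxAl -scalemxAr mul_delta_mx_0 //.
  by rewrite !scaler0 addr0 scaleNr addrNK.
have EE c : (E c *m S *m (E c)^T) 0 0 = c * S 0 j *+ 2 + c ^+ 2 * S j j.
  have rowE k : (E c *m S) 0 k = S 0 k + c * S j k.
    rewrite /E mulmxDl mul1mx -scalemxAl !mxE (bigD1 j) //= mxE !eqxx mul1r.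
    by rewrite big1 ?addr0 // => i ne_ij; rewrite mxE (negPf ne_ij) andbF mul0r.
  have colE (M : 'M[K]_n.+1) : (M *m (E c)^T) 0 0 = M 0 0 + c * M 0 j.
    rewrite /E linearD /= trmx1 mulmxDr mulmx1 linearZ /= -scalemxAr trmx_delta.
    rewrite !mxE (bigD1 j) //= mxE !eqxx mulr1 big1 ?addr0 // => i ne_ij.
    by rewrite mxE (negPf ne_ij) mulr0.
  by rewrite colE !rowE S00 -[in S j 0]symS mxE; ring.
have [E1|] := eqVneq ((E 1 *m S *m (E 1)^T) 0 0) 0; last by exists (E 1); [|left].
exists (E (-1)) => //; left; apply: contraNneq S0j => E2.
have : S 0 j *+ 4 = 0.
  by rewrite -[RHS](subrr 0) -{1}E1 -E2 !EE; ring.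
by move/eqP; rewrite mulrn_eq0.
Qed.

(** Induction as in a Cholesky factorisation: over a closed field the pivot has a square root, and
    the Schur complement is factored recursively. *)
Lemma sym_factor (K : numClosedFieldType) n (S : 'M[K]_n) : S^T = S ->
  exists N : 'M[K]_n, S = N *m N^T.
Proof.
elim: n S => [|n IHn] S symS; first by exists 0; apply/matrixP => -[].
have congr_factor (T : 'M[K]_n.+1) : T^T = T -> T 0 0 != 0 \/ (forall j, T 0 j = 0) ->
    exists N : 'M[K]_n.+1, T = N *m N^T.
  clear S symS; rewrite -[n.+1]/(1 + n)%N in T * => symT Tpiv.
  have symul : (ulsubmx T)^T = ulsubmx T by rewrite trmx_ulsub symT.
  pose s := sqrtC (T 0 0); pose w := s^-1 *: dlsubmx T.
  have ul : ulsubmx T = (s ^+ 2)%:M.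
    by rewrite [LHS]mx11_scalar sqrtCK !mxE !lshift0.
  (* For a zero pivot the inverse of [s] is 0, but then [Tpiv] makes the first row zero, hence also
     the first column by symmetry. *)
  have sw : s *: w = dlsubmx T.
    have [s0|nz_s] := eqVneq s 0; last by rewrite scalerA divff ?scale1r.
    rewrite s0 scale0r; move/eqP: s0; rewrite sqrtC_eq0 => T00.
    case: Tpiv => [|T0]; first by rewrite T00.
    apply/matrixP => i j; rewrite -symT !mxE (ord1 j).
    by apply/esym; apply: etrans (T0 (rshift 1 i)); congr (T _ _); apply/val_inj.
  have [|N' N'E] := IHn (drsubmx T - w *m w^T).
    by rewrite linearB /= trmx_mul trmxK trmx_drsub symT.
  exists (block_mx s%:M 0 w N').
  rewrite tr_block_mx mulmx_block -[LHS]submxK !trmx0 !mulmx0 !mul0mx !addr0.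
  rewrite tr_scalar_mx ul -scalar_mxM -expr2 mul_scalar_mx mul_mx_scalar sw.
  by rewrite -N'E addrC subrK -linearZ /= sw trmx_dlsub symT.
have [E unitE Epiv] := sym_pivot symS.
have [|N NE] := congr_factor (E *m S *m E^T) _ Epiv.
  by rewrite !trmx_mul trmxK symS mulmxA.
exists (invmx E *m N).
rewrite trmx_mul mulmxA -(mulmxA _ N) -NE !mulmxA mulVmx // mul1mx.
by rewrite -mulmxA -trmx_mul mulVmx // trmx1 mulmx1.
Qed.

(** Nullstellensatz for a nonsingular quadric. Writing A = N N^T, a linear change of variables makes
    the form a sum of squares, monic in the last variable; as there are at least two variables, the
    other squares have a nonzero sum [Q]. *)
Lemma dvd_of_vanishing_quadric (K : numClosedFieldType) n (A : 'M[K]_n.+2)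
    (g : {mpoly K[n.+2]}) : A^T = A -> A \in unitmx ->
    (forall x : 'rV_n.+2, (x *m A *m x^T) 0 0 = 0 -> g.@[x 0] = 0) ->
  exists h, g = qform A * h.
Proof.
move=> symA unitA g0; have [N NE] := sym_factor symA.
have unitN : N \in unitmx by move: unitA; rewrite NE unitmx_mul => /andP[].
pose Q : {mpoly K[n.+1]} := \sum_i 'X_i ^+ 2.
have qE (y : 'rV[K]_n.+2) : (mwiden Q + 'X_ord_max ^+ 2).@[y 0] = (y *m y^T) 0 0.
  rewrite mevalD meval_mwiden raddf_sum [RHS]mxE [RHS]big_ord_recr /=.
  rewrite rmorphXn /= mevalXU !mxE -expr2; congr (_ + _).
  by apply: eq_bigr => i _; rewrite rmorphXn /= mevalXU !mxE -expr2.
have nzQ : Q != 0.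
  have Qe : Q.@[fun i => (i == 0)%:R] = 1.
    rewrite raddf_sum big_ord_recl big1 /= ?addr0 => [|i _].
      by rewrite rmorphXn /= mevalXU expr1n.
    by rewrite rmorphXn /= mevalXU expr0n.
  by apply/eqP => Q0; move/eqP: Qe; rewrite Q0 meval0 eq_sym oner_eq0.
have [v v0|h gh] := @dvd_of_vanishing_square _ _ Q (g \mPo linear_subst (invmx N)) nzQ.
  pose y : 'rV_n.+2 := \row_i v i.
  have yv : y 0 =1 v by move=> i; rewrite mxE.
  rewrite -(meval_eq _ yv) meval_linear_subst g0 // NE trmx_mul.
  move: v0; rewrite -(meval_eq _ yv) qE => <-.
  by rewrite !mulmxA mulmxKV // -(mulmxA y) -trmx_mul mulVmx // trmx1 mulmx1.
exists (h \mPo linear_subst N); apply: mpoly_eq_rV => x.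
rewrite mevalM meval_linear_subst meval_qform NE -!mulmxA -trmx_mul mulmxA.
rewrite -qE -mevalM -gh meval_linear_subst mulmxK //.
Qed.

(** * Products of two lines *)

Section Segre.
Variable K : fieldType.
Implicit Types (s t : 'rV[K]_2) (z : 'rV[K]_4) (U V : 'M[K]_(2, 4)).

Definition segre s t : 'rV[K]_4 :=
  \row_k [:: s 0 0 * t 0 0; s 0 0 * t 0 1; s 0 1 * t 0 0; s 0 1 * t 0 1]`_k.

(* The polar form of 2 (z_0 z_3 - z_1 z_2), whose quadric is the Segre quadric. *)
Definition segre_mx : 'M[K]_4 := \matrix_(i, j)
  (nth [::] [:: [:: 0; 0; 0; 1]; [:: 0; 0; -1; 0]; [:: 0; -1; 0; 0];
                [:: 1; 0; 0; 0]] i)`_j.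

Lemma segre_mx_sym : segre_mx^T = segre_mx.
Proof.
by apply/matrixP => -[[|[|[|[|//]]]] ?] -[[|[|[|[|//]]]] ?]; rewrite !mxE.
Qed.

Lemma segre_mxK : segre_mx *m segre_mx = 1%:M.
Proof.
apply/matrixP => i j; rewrite mxE !big_ord_recl big_ord0 !mxE /=.
case: i j => [[|[|[|[|//]]]] ?] [[|[|[|[|//]]]] ?];
  rewrite eqE /= ?mulr1n ?mulr0n; ring.
Qed.

Lemma segre_mxE z : (z *m segre_mx *m z^T) 0 0 =
  (z 0 0 * z 0 3 - z 0 1 * z 0 2) *+ 2.
Proof.
rewrite !mxE !big_ord_recl big_ord0 !mxE !big_ord_recl !big_ord0 !mxE /=.
have -> : lift ord0 ord0 = 1 :> 'I_4 by apply/val_inj.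
have -> : lift ord0 (lift ord0 ord0) = 2 :> 'I_4 by apply/val_inj.
have -> : lift ord0 (lift ord0 (lift ord0 ord0)) = 3 :> 'I_4 by apply/val_inj.
have -> : ord0 = 0 :> 'I_4 by apply/val_inj.
ring.
Qed.

Lemma segre_isotropic s t : (segre s t *m segre_mx *m (segre s t)^T) 0 0 = 0.
Proof. by rewrite segre_mxE !mxE /=; ring. Qed.

End Segre.

(** As a 2 x 2 matrix, [z] has determinant zero. If its corner is nonzero, the second row is a
    multiple of the first; otherwise the first row or the first column vanishes. *)
Lemma segreP (K : numFieldType) (z : 'rV[K]_4) :
  (z *m segre_mx K *m z^T) 0 0 = 0 -> exists s t, z = segre s t.
Proof.
rewrite segre_mxE => /eqP; rewrite mulrn_eq0 /= subr_eq0 => /eqP z03.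
pose vec (a b : K) : 'rV[K]_2 := \row_i [:: a; b]`_i.
have zE (s t : 'rV_2) : z 0 0 = s 0 0 * t 0 0 -> z 0 1 = s 0 0 * t 0 1 ->
    z 0 2 = s 0 1 * t 0 0 -> z 0 3 = s 0 1 * t 0 1 -> z = segre s t.
  move=> z0 z1 z2 z3; apply/rowP => i; rewrite mxE.
  by case: i => [[|[|[|[|//]]]] ilt] /=; rewrite -?z0 -?z1 -?z2 -?z3;
    congr (z _ _); apply/val_inj.
have [z0|nz_z0] := eqVneq (z 0 0) 0; last first.
  exists (vec 1 (z 0 2 / z 0 0)), (vec (z 0 0) (z 0 1)).
  apply: zE; rewrite !mxE /= ?mul1r ?divfK //.
  by apply: (mulfI nz_z0); rewrite z03; field.
move: z03; rewrite z0 mul0r => /esym/eqP; rewrite mulf_eq0 => /orP[]/eqP z1.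
  exists (vec 0 1), (vec (z 0 2) (z 0 3)).
  by apply: zE; rewrite !mxE /= ?z0 ?z1; ring.
exists (vec (z 0 1) (z 0 3)), (vec 0 1).
by apply: zE; rewrite !mxE /= ?z0 ?z1; ring.
Qed.

Section HadamardMatrix.
Variable K : fieldType.
Implicit Types (s t : 'rV[K]_2) (U V : 'M[K]_(2, 4)).

(** The rows of [U] and [V] are meant to span two lines; their [i]-th columns then represent the
    [i]-th coordinate restricted to each line. *)
Definition hadamard_mx U V : 'M[K]_4 :=
  \matrix_i segre (row i U^T) (row i V^T).

Lemma hmul_segre s t U V :
  hmul (s *m U) (t *m V) = segre s t *m (hadamard_mx U V)^T.
Proof.
apply/rowP => i; rewrite !mxE !big_ord_recl !big_ord0 !mxE /=.
rewrite (_ : lift ord0 ord0 = 1 :> 'I_2); last exact/val_inj.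
ring.
Qed.

Lemma row_hadamard_mx U V i :
  row i (hadamard_mx U V) = segre (row i U^T) (row i V^T).
Proof. exact: rowK. Qed.

(** A relation [c] between the rows of [U] gives the kernel vector c (x) e_0 of the matrix, and one
    between the rows of [V] gives e_0 (x) c. Thus an invertible matrix comes from two genuine
    lines. *)
Lemma hadamard_mx_free U V : hadamard_mx U V \in unitmx ->
  row_free U /\ row_free V.
Proof.
move=> unitM.
have free (x : 'cV[K]_4) : hadamard_mx U V *m x = 0 -> x = 0.
  by move=> Mx; rewrite -[x](mulKmx unitM) Mx mulmx0.
have o2 : lift ord0 ord0 = 1 :> 'I_2 by apply/val_inj.
have rel (c : 'rV[K]_2) (W : 'M[K]_(2, 4)) i : c *m W = 0 ->
      c 0 0 * W 0 i + c 0 1 * W 1 i = 0.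
  by move=> /rowP/(_ i); rewrite !mxE !big_ord_recl big_ord0 o2 addr0.
split; rewrite -kermx_eq0; apply/rowV0P => c /sub_kermxP c0; have cW i := rel _ _ i c0.
- have /free /colP x0 : hadamard_mx U V *m (\col_k [:: c 0 0; 0; c 0 1; 0]`_k) = 0.
    apply/colP => i; rewrite !mxE !big_ord_recl big_ord0 !mxE /=.
    by transitivity ((c 0 0 * U 0 i + c 0 1 * U 1 i) * V 0 i); [ring | rewrite cW mul0r].
  apply/rowP => -[[|[|//]] ilt]; rewrite mxE;
    [have := x0 0 | have := x0 2]; rewrite !mxE /= => <-; congr (c _ _); exact/val_inj.
- have /free /colP x0 : hadamard_mx U V *m (\col_k [:: c 0 0; c 0 1; 0; 0]`_k) = 0.
    apply/colP => i; rewrite !mxE !big_ord_recl big_ord0 !mxE /=.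
    by transitivity ((c 0 0 * V 0 i + c 0 1 * V 1 i) * U 0 i); [ring | rewrite cW mul0r].
  apply/rowP => -[[|[|//]] ilt]; rewrite mxE;
    [have := x0 0 | have := x0 1]; rewrite !mxE /= => <-; congr (c _ _); exact/val_inj.
Qed.

End HadamardMatrix.

Lemma is_lineP (K : fieldType) n (X : set (proj 'rV[K]_n)) :
  is_line X <-> exists2 U : 'M[K]_(2, n), row_free U &
    X = [set p | exists s, val p = <[s *m U]>%VS].
Proof.
split=> [[S] [dimS ->]|[U freeU ->]].
  pose U : 'M[K]_(2, n) := \matrix_i (vbasis S)`_i.
  have SE x : x \in S <-> exists s, x = s *m U.
    split=> [/coord_vbasis xE|[s ->]]; last first.
      rewrite mulmx_sum_row rpred_sum // => i _; rewrite rpredZ // rowK.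
      by rewrite vbasis_mem // mem_nth // size_tuple dimS.
    exists (\row_i coord (vbasis S) (cast_ord (esym dimS) i) x).
    rewrite mulmx_sum_row {1}xE (reindex (cast_ord (esym dimS))) /=; last first.
      by exists (cast_ord dimS) => i _; rewrite ?cast_ordK ?cast_ordKV.
    by apply: eq_bigr => i _; rewrite mxE rowK.
  exists U.
    rewrite -kermx_eq0; apply/rowV0P => c /sub_kermxP.
    rewrite mulmx_sum_row => cU0.
    have /freeP := basis_free (vbasisP S).
    move=> /(_ (fun i => c 0 (cast_ord dimS i))) c0; apply/rowP => i.
    rewrite mxE -(cast_ordKV dimS i) c0 // -[RHS]cU0.
    rewrite (reindex (cast_ord (esym dimS))) /=; last first.
      by exists (cast_ord dimS) => j _; rewrite ?cast_ordK ?cast_ordKV.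
    by apply: eq_bigr => j _; rewrite rowK cast_ordKV.
  apply/seteqP; split=> p /= [].
    have [v _ pv] := proj_line p; rewrite pv -memvE => /SE[s vE].
    by exists s; rewrite -vE.
  by move=> s ->; rewrite -memvE; apply/SE; exists s.
pose f : 'Hom('rV[K]_2, 'rV[K]_n) := linfun (mulmxr U).
exists (limg f); split.
  have ker0 : lker f = 0%VS.
    by apply/eqP/lker0P => s t; rewrite !lfunE /=; exact: row_free_inj.
  have := limg_ker_dim f fullv; rewrite ker0 capv0 dimv0 add0n => ->.
  by rewrite dimvf /dim /= mul1n.
apply/seteqP; split=> p /= [].
  by move=> s ->; rewrite -memvE; apply/memv_imgP; exists s; rewrite ?memvf // lfunE.
have [v _ pv] := proj_line p; rewrite pv -memvE => /memv_imgP[s _ vE].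
by exists s; rewrite vE lfunE.
Qed.

(** The choice of representatives only rescales a product, and a nonzero product forces both factors
    to be nonzero, so being defined needs no separate condition on the right. *)
Lemma hadamard_lines (K : fieldType) (U V : 'M[K]_(2, 4)) :
  [set r : proj 'rV[K]_4 | exists p q,
     [/\ exists s, val p = <[s *m U]>%VS, exists t, val q = <[t *m V]>%VS
       & is_hadamard p q r]] =
  [set r | exists s t, val r = <[segre s t *m (hadamard_mx U V)^T]>%VS].
Proof.
have hmulZ a b (u v : 'rV[K]_4) : hmul (a *: u) (b *: v) = (a * b) *: hmul u v.
  by apply/rowP => i; rewrite !mxE; ring.
have nz_val (r : proj 'rV[K]_4) v : val r = <[v]>%VS -> v != 0.
  by move=> rv; have := valP r; rewrite rv dim_vline eqb1.
apply/seteqP; split=> r /=.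
  move=> [p] [q] [[s ps] [t qt] [u] [v] [pu qv ruv]].
  have [a uE] : exists a, u = a *: (s *m U) by apply: vline_eq; rewrite -pu.
  have [b vE] : exists b, v = b *: (t *m V) by apply: vline_eq; rewrite -qv.
  exists s, t; have := nz_val _ _ ruv; rewrite ruv uE vE hmulZ hmul_segre.
  by rewrite scaler_eq0 negb_or => /andP[ab _]; rewrite vlineZ.
move=> [s] [t]; rewrite -hmul_segre => rst; have nz_r := nz_val _ _ rst.
have nz_s : s *m U != 0.
  by apply: contraNneq nz_r => ->; apply/eqP/rowP => i; rewrite !mxE mul0r.
have nz_t : t *m V != 0.
  by apply: contraNneq nz_r => ->; apply/eqP/rowP => i; rewrite !mxE mulr0.
have [p ps] := proj_point nz_s; have [q qt] := proj_point nz_t.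
exists p, q; split; [by exists s | by exists t |].
by exists (s *m U), (t *m V).
Qed.

Lemma dhomog_msize_eq (K : fieldType) n d (p : {mpoly K[n]}) :
  p != 0 -> p \is d.-homog -> msize p = d.+1.
Proof.
by move=> nz_p /dhomogP pd; rewrite -mlead_deg // (pd _ (mlead_supp nz_p)).
Qed.

Lemma qform_linear_neq0 (K : numFieldType) (P : 'M[K]_4) : P \in unitmx ->
  qform (P *m segre_mx K *m P^T) != 0.
Proof.
(* The polar form takes the value 2 at [z]. *)
move=> unitP; pose z : 'rV[K]_4 := \row_i [:: 1; 0; 0; 1]`_i.
apply/eqP => q0; have := meval_qform (P *m segre_mx K *m P^T) (z *m invmx P).
rewrite q0 meval0 trmx_mul !mulmxA mulmxKV // -(mulmxA _ P^T) -trmx_mul mulVmx //.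
rewrite trmx1 mulmx1 segre_mxE !mxE /= => /esym/eqP.
by rewrite mulr1 mulr0 subr0 pnatr_eq0.
Qed.

(** * Equality of the two sets of quadrics *)

Section HadamardQuadrics.
Variable K : numClosedFieldType.
Implicit Types (U V : 'M[K]_(2, 4)) (w : quadric K).
Local Notation D := (segre_mx K).

(** For invertible [M], the matrix of the image of the Segre quadric under z |-> z M^T. As
    [segre_mx] is an involution, its inverse is [M *m D *m M^T]. *)
Definition segre_quadric (M : 'M[K]_4) := (invmx M)^T *m D *m invmx M.

Lemma segre_quadricE (M : 'M[K]_4) (z : 'rV[K]_4) : M \in unitmx ->
  ((z *m M^T) *m segre_quadric M *m (z *m M^T)^T) 0 0 = (z *m D *m z^T) 0 0.
Proof.
move=> unitM; rewrite /segre_quadric trmx_mul trmxK !mulmxA.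
by rewrite mulmxKV // -(mulmxA z) -trmx_mul mulVmx // trmx1 mulmx1.
Qed.

Lemma segre_quadric_sym M : (segre_quadric M)^T = segre_quadric M.
Proof. by rewrite !trmx_mul trmxK segre_mx_sym mulmxA. Qed.

Lemma segre_quadricK M : M \in unitmx ->
  segre_quadric M *m (M *m D *m M^T) = 1%:M.
Proof.
move=> unitM; rewrite !mulmxA mulmxKV // -(mulmxA _ D D) segre_mxK mulmx1.
by rewrite -trmx_mul mulmxV // trmx1.
Qed.

(** Every form vanishing on the image is a multiple of [q]. A nonzero left kernel vector of the
    matrix would give a vanishing linear form, of too low degree; so the matrix is invertible, and
    the form of [segre_quadric] is a multiple of [q] of the same degree. *)
Lemma quadric_of_hadamard w q U V : val w = <[q]>%VS ->
    hypersurface_of q (zclosure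
      [set r | exists s t, val r = <[segre s t *m (hadamard_mx U V)^T]>%VS]) ->
  exists2 c, c != 0 &
    hadamard_mx U V \in unitmx /\
    val q = c *: qform (segre_quadric (hadamard_mx U V)).
Proof.
set M := hadamard_mx U V; set S0 := [set r | _] => wq [_ q_gen].
have nz_q : val q != 0.
  by have := valP w; rewrite wq dim_vline eqb1; apply: contra_neq => q0; apply/val_inj.
have sz_q := dhomog_msize_eq nz_q (dhomog_is_dhomog q).
have vanish d (g : {mpoly K[4]}) : g \is d.-homog ->
    (forall s t, g.@[(segre s t *m M^T) 0] = 0) -> exists h, g = val q * h.
  move=> gd g0; apply/(q_gen d) => //; apply: zclosure_vanishes.
    exact: hom_polyfun_mpoly_fun gd.
  move=> p [s] [t] pst; apply/(vanishes_atE (hom_polyfun_mpoly_fun gd) pst).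
  exact: g0.
have unitM : M \in unitmx.
  rewrite -row_free_unit -kermx_eq0; apply/rowV0P => c /sub_kermxP cM.
  pose g : {mpoly K[4]} := \sum_i c 0 i *: 'X_i.
  have gE (x : 'rV[K]_4) : g.@[x 0] = (x *m c^T) 0 0.
    rewrite raddf_sum mxE; apply: eq_bigr => i _ /=.
    by rewrite mevalZ mevalXU !mxE mulrC.
  have g_hom : g \is 1.-homog.
    by rewrite rpred_sum // => i _; rewrite rpredZ // dhomogX /= mdeg1.
  have [|h gh] := vanish 1%N g g_hom.
    by move=> s t; rewrite gE -mulmxA -trmx_mul cM trmx0 mulmx0 mxE.
  have [g0|nz_g] := eqVneq g 0.
    apply/rowP => i; have := gE (delta_mx 0 i).
    by rewrite g0 meval0 -rowE !mxE.
  have nz_h : h != 0 by apply: contraNneq nz_g => h0; rewrite gh h0 mulr0.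
  have := dhomog_msize_eq nz_g g_hom; rewrite gh msizeM // sz_q.
  by have := msize_poly_eq0 h; rewrite (negPf nz_h); case: (msize h).
pose A := segre_quadric M.
have nz_A : qform A != 0.
  have := @qform_linear_neq0 _ (invmx M)^T; rewrite trmxK; apply.
  by rewrite unitmx_tr unitmx_inv.
have [h qh] : exists h, qform A = val q * h.
  apply: vanish (qform_homog A) _.
  by move=> s t; rewrite meval_qform segre_quadricE // segre_isotropic.
have nz_h : h != 0 by apply: contraNneq nz_A => h0; rewrite qh h0 mulr0.
have := dhomog_msize_eq nz_A (qform_homog A); rewrite qh msizeM // sz_q.
rewrite addSn addSn addSn /= => -[] /eqP; rewrite eqn_add2l => sz_h.
have /msize_poly1P[c nz_c hc] : msize h == 1%N by [].
exists c^-1; first by rewrite invr_eq0.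
by split=> //; rewrite hc mulrC mul_mpolyC scalerA mulVf // scale1r.
Qed.

Lemma hadamard_sub_zero_diag :
  hadamard_quadrics K `<=` zero_diag_inverse_quadrics K.
Proof.
move=> w [q] [L] [R] [wq /is_lineP[U _ ->] /is_lineP[V _ ->]].
rewrite /hadamard_prod hadamard_lines => /(quadric_of_hadamard wq).
set M := hadamard_mx U V => -[c nz_c [unitM qE]].
have AK : (c *: segre_quadric M) *m (c^-1 *: (M *m D *m M^T)) = 1%:M.
  by rewrite -scalemxAl -scalemxAr scalerA divff // scale1r segre_quadricK.
have [unitA _] := mulmx1_unit AK.
exists (c *: segre_quadric M); split=> //.
- by rewrite linearZ /= segre_quadric_sym.
- have -> : invmx (c *: segre_quadric M) = c^-1 *: (M *m D *m M^T).
    by rewrite -[RHS](mulKmx unitA) AK mulmx1.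
  move=> i; rewrite mxE (_ : (M *m D *m M^T) i i = 0) ?mulr0 //.
  have := segre_isotropic (row i U^T) (row i V^T).
  rewrite -row_hadamard_mx -/M => <-; rewrite -row_mul tr_row -row_mul.
  by rewrite !mxE; apply: eq_bigr => j _; rewrite !mxE.
- exists q; split=> // x; rewrite /mpoly_fun qE mevalZ meval_qform.
  by rewrite -scalemxAr -scalemxAl [RHS]mxE.
Qed.

(** Both [B] and [D] are congruent to the identity, through [N] and [E], so M = N E^-1 carries [D]
    to [B]. As [B] has zero diagonal, the rows of [M] are isotropic, hence rank one tensors, from
    which [U] and [V] are read off. *)
Lemma isotropic_factor (B : 'M[K]_4) : B^T = B -> B \in unitmx ->
    (forall i, B i i = 0) ->
  exists U V, hadamard_mx U V \in unitmx /\
    B = hadamard_mx U V *m D *m (hadamard_mx U V)^T.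
Proof.
move=> symB unitB B0; have [N NE] := sym_factor symB.
have [E EE] := sym_factor (segre_mx_sym K).
have unitN : N \in unitmx by move: unitB; rewrite NE unitmx_mul => /andP[].
have unitE : E \in unitmx.
  by have [] := mulmx1_unit (segre_mxK K); rewrite EE unitmx_mul => /andP[].
pose M := N *m invmx E.
have ME : M *m D *m M^T = B.
  rewrite EE trmx_mul NE !mulmxA mulmxKV // -2!mulmxA (mulmxA E^T) -trmx_mul.
  by rewrite mulVmx // trmx1 mul1mx.
have rowM i : exists st : 'rV[K]_2 * 'rV[K]_2, row i M = segre st.1 st.2.
  have [|s [t st]] := @segreP _ (row i M); last by exists (s, t).
  rewrite -[RHS](B0 i) -ME -row_mul tr_row.
  by rewrite !mxE; apply: eq_bigr => j _; rewrite !mxE.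
have [st stE] := boolp.choice rowM.
exists (\matrix_(a, i) (st i).1 0 a), (\matrix_(a, i) (st i).2 0 a).
suff -> : hadamard_mx (\matrix_(a, i) (st i).1 0 a)
    (\matrix_(a, i) (st i).2 0 a) = M by rewrite unitmx_mul unitN unitmx_inv.
apply/row_matrixP => i; rewrite stE row_hadamard_mx.
by congr segre; apply/rowP => a; rewrite !mxE.
Qed.

(** The lines come from [isotropic_factor]. Their set of products is the whole zero locus of [q],
    hence already closed, and [dvd_of_vanishing_quadric] shows that [q] generates the ideal. *)
Lemma zero_diag_sub_hadamard :
  zero_diag_inverse_quadrics K `<=` hadamard_quadrics K.
Proof.
move=> w [A] [symA unitA A0 [q [wq qA]]].
have [||U [V [unitM AM]]] := @isotropic_factor (invmx A) _ _ A0.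
- by rewrite trmx_inv symA.
- by rewrite unitmx_inv.
set M := hadamard_mx U V in unitM AM.
have AE : A = segre_quadric M.
  have := segre_quadricK unitM; rewrite -AM => SA.
  by rewrite -[RHS](mulmxKV unitA) SA mul1mx.
have qE : val q = qform A.
  by apply: mpoly_eq_rV => x; rewrite meval_qform -qA.
have [freeU freeV] := hadamard_mx_free unitM.
exists q, [set p | exists s, val p = <[s *m U]>%VS],
  [set p | exists t, val p = <[t *m V]>%VS].
split=> //; [by apply/is_lineP; exists U | by apply/is_lineP; exists V |].
rewrite /hadamard_prod hadamard_lines -/M; set S0 := [set r | _].
have q_hom : hom_polyfun 2 (mpoly_fun (val q)).
  exact: hom_polyfun_mpoly_fun (dhomog_is_dhomog q).
have qz z : mpoly_fun (val q) (z *m M^T) = (z *m D *m z^T) 0 0.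
  by rewrite qA AE segre_quadricE.
have S0E : S0 = [set p | vanishes_at (mpoly_fun (val q)) p].
  apply/seteqP; split=> p /=.
    move=> [s] [t] pst; apply/(vanishes_atE q_hom pst).
    by rewrite qz segre_isotropic.
  have [x _ px] := proj_line p; move=> /(vanishes_atE q_hom px).
  rewrite -[x](mulmxKV (_ : M^T \in unitmx)) ?unitmx_tr // qz => /segreP[s [t st]].
  by exists s, t; rewrite -st mulmxKV ?unitmx_tr.
have -> : zclosure S0 = S0.
  apply/seteqP; split; last exact: sub_zclosure.
  by apply: zclosure_min => //; rewrite S0E; apply: zclosed_vanishes q_hom.
split=> // e g ge; split=> [gS|[h ->] p]; last first.
  by rewrite S0E => qp v /qp; rewrite /mpoly_fun mevalM => ->; rewrite mul0r.
(* This settles the origin, which represents no point: a function vanishing at [p] vanishes on a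
   whole line through the origin. *)
have [p pS] : exists p, S0 p.
  pose z : 'rV[K]_4 := segre (delta_mx 0 0) (delta_mx 0 0).
  have [|p pz] := @proj_point _ _ (z *m M^T).
    apply/eqP => zM; have z0 : z = 0.
      by rewrite -[z](mulmxK (_ : M^T \in unitmx)) ?unitmx_tr // zM mul0mx.
    by move/rowP/(_ 0): z0; rewrite !mxE /= mulr1 => /eqP; rewrite oner_eq0.
  by exists p, (delta_mx 0 0), (delta_mx 0 0).
rewrite qE; apply: dvd_of_vanishing_quadric => // x xA.
have [->|nz_x] := eqVneq x 0; first by apply: (gS p pS); rewrite mem0v.
have [r rx] := proj_point nz_x; apply: (gS r); last by rewrite rx memv_line.
by rewrite S0E; apply/(vanishes_atE q_hom rx); rewrite qA.
Qed.

Lemma hadamard_quadricsE : hadamard_quadrics K = zero_diag_inverse_quadrics K.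
Proof.
by apply/seteqP; split; [exact: hadamard_sub_zero_diag | exact: zero_diag_sub_hadamard].
Qed.

End HadamardQuadrics.

(** * Length of chains of irreducible closed sets *)

Section ChainIndependence.
Variables (K : fieldType) (V : vectType K) (e D : nat).
Variables (c : nat -> set (proj V)) (f : nat -> V -> K).
Hypothesis c_irr : forall i, (i <= e)%N -> zirreducible (c i).
Hypothesis c_sub : forall i, (i < e)%N -> c i `<=` c i.+1.
Hypothesis f_hom : forall i, (i <= e)%N -> hom_polyfun D (f i).
Hypothesis f_neq0 : forall i, (i <= e)%N -> exists2 p, c i p & ~ vanishes_at (f i) p.
Hypothesis f_eq0 : forall i, (i < e)%N -> forall p, c i p -> vanishes_at (f i.+1) p.

Definition chain_monomial k (m : nat -> nat) (v : V) : K :=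
  \prod_(i < k.+1) f i v ^+ m i.

Lemma chain_monomial_homog k (m : nat -> nat) : (k <= e)%N ->
  hom_polyfun (D * \sum_(i < k.+1) m i) (chain_monomial k m).
Proof.
move=> le_ke; rewrite big_distrr /=; apply: hom_polyfun_prod => i.
by apply/hom_polyfunX/f_hom/(leq_trans _ le_ke); rewrite -ltnS.
Qed.

Lemma chain_monomialS k m v :
  chain_monomial k.+1 m v = chain_monomial k m v * f k.+1 v ^+ m k.+1.
Proof. by rewrite /chain_monomial big_ord_recr. Qed.

(* On c_k, the least power of f_k occurring in a relation can be cancelled, as
   c_k is irreducible; on c_(k-1) only the terms with that power survive. *)
Lemma chain_independent (J : finType) (ex : J -> nat -> nat) (a : J -> K) k
    (P : pred J) n : (k <= e)%N -> (exists j, P j) -> (forall j, P j -> a j != 0) ->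
    (forall j, P j -> \sum_(i < k.+1) ex j i = n)%N ->
    {in P &, forall j j', (forall i, (i <= k)%N -> ex j i = ex j' i) -> j = j'} ->
  ~ (forall p, c k p ->
       vanishes_at (fun v => \sum_(j | P j) a j * chain_monomial k (ex j) v) p).
Proof.
elim: k P n => [|k IHk] P n le_ke [j0 Pj0] a_neq0 exn ex_inj van.
  (* For [k = 0] the degree condition leaves a single monomial, a power of [f 0]. *)
  have [p cp f0p] := f_neq0 le_ke; apply: f0p => v pv.
  have := van p cp v pv; rewrite (big_pred1 j0) => [|j /=]; last first.
    apply/idP/eqP => [Pj|-> //]; apply: ex_inj => // i; rewrite leqn0 => /eqP->.
    by have := exn j Pj; rewrite -(exn j0 Pj0) !big_ord1.
  move/eqP; rewrite mulf_eq0 (negPf (a_neq0 _ Pj0)) /chain_monomial big_ord1 /=.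
  by rewrite expf_eq0 => /andP[_ /eqP].
have lt_ke : (k < e)%N := le_ke.
have [j1 Pj1 j1_min] := arg_minnP (fun j => ex j k.+1) Pj0.
pose s := ex j1 k.+1.
pose G v := \sum_(j | P j)
  a j * (chain_monomial k (ex j) v * f k.+1 v ^+ (ex j k.+1 - s)).
have exk j : P j -> (\sum_(i < k.+1) ex j i + ex j k.+1)%N = n.
  by move=> Pj; rewrite -(exn j Pj) [RHS]big_ord_recr.
have G_hom : hom_polyfun (D * (n - s)) G.
  apply: hom_polyfun_sum => j Pj; apply: hom_polyfunZ.
  have -> : (n - s = \sum_(i < k.+1) ex j i + (ex j k.+1 - s))%N.
    by rewrite addnBA ?exk // j1_min.
  rewrite mulnDr; apply: hom_polyfunM; first exact: chain_monomial_homog (ltnW le_ke).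
  exact/hom_polyfunX/f_hom.
have FG v : \sum_(j | P j) a j * chain_monomial k.+1 (ex j) v = f k.+1 v ^+ s * G v.
  rewrite big_distrr /=; apply: eq_bigr => j Pj; rewrite chain_monomialS.
  by rewrite -{1}(subnK (j1_min j Pj)) -/s exprD; ring.
have G0 : c k.+1 `<=` [set p | vanishes_at G p].
  have [_ irr] := c_irr le_ke.
  have [||p cp|fk0|//] := irr [set p | vanishes_at (f k.+1) p] [set p | vanishes_at G p].
  - exact/zclosed_vanishes/f_hom.
  - exact: zclosed_vanishes G_hom.
  - have [v _ pv] := proj_line p.
    have /eqP : f k.+1 v ^+ s * G v = 0.
      by rewrite -FG; apply: (van p cp); rewrite pv memv_line.
    rewrite mulf_eq0 expf_eq0 => /orP[/andP[_ /eqP fv]|/eqP Gv].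
      by left; apply/(vanishes_atE (f_hom le_ke) pv).
    by right; apply/(vanishes_atE G_hom pv).
  - by have [p /fk0] := f_neq0 le_ke.
apply: (IHk [pred j | P j && (ex j k.+1 == s)] (n - s)%N (ltnW le_ke)).
- by exists j1; rewrite /= Pj1 eqxx.
- by move=> j /andP[/a_neq0].
- by move=> j /andP[Pj /eqP js]; rewrite -(exk j Pj) js addnK.
- move=> j j' /andP[Pj /eqP js] /andP[Pj' /eqP j's] jj'; apply: ex_inj => // i.
  by rewrite leq_eqVlt => /predU1P[->|/jj' //]; rewrite js j's.
- move=> p cp v pv; rewrite -[RHS](G0 p (c_sub lt_ke cp) v pv).
  rewrite /G [RHS](bigID (fun j => ex j k.+1 == s)) /= [X in _ + X]big1 ?addr0.
    by apply: eq_bigr => j /andP[_ /eqP->]; rewrite subnn expr0 mulr1.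
  move=> j /andP[Pj ne_js]; rewrite (f_eq0 lt_ke cp pv) expr0n.
  rewrite subn_eq0 leqNgt ltn_neqAle eq_sym ne_js (j1_min j Pj) /=.
  by rewrite !mulr0.
Qed.

End ChainIndependence.

(** Each step of the chain yields a form vanishing on one member but not on the next; suitable
    powers of these forms have equal degrees. *)
Lemma irr_chain_forms (K : fieldType) (V : vectType K) (Z : set (proj V)) e c :
  irr_chain Z e c -> exists D f,
    [/\ forall i, (i <= e)%N -> hom_polyfun D (f i),
        forall i, (i <= e)%N -> exists2 p, c i p & ~ vanishes_at (f i) p
      & forall i, (i < e)%N -> forall p, c i p -> vanishes_at (f i.+1) p].
Proof.
move=> [c_irr c_lt].
have sep i : exists dF : nat * (V -> K), (i <= e)%N ->
    [/\ (0 < dF.1)%N, hom_polyfun dF.1 dF.2,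
        exists2 p, c i p & ~ vanishes_at dF.2 p
      & forall k, i = k.+1 -> forall p, c k p -> vanishes_at dF.2 p].
  have [le_ie|] := leqP i e; last by exists (0%N, fun=> 0).
  case: i le_ie => [|i] le_ie.
    (* The first member has no predecessor: a coordinate that is nonzero at one of its points will
       do. *)
    have [_ [[p cp] _] _] := c_irr 0%N le_ie.
    have [v nz_v pv] := proj_line p.
    have /existsP[k vk] : [exists k, coord (vbasis {:V}) k v != 0].
      apply: contraNT nz_v; rewrite negb_exists => /forallP v0.
      rewrite (coord_vbasis (memvf v)) big1 // => k _.
      by have := v0 k; rewrite negbK => /eqP->; rewrite scale0r.
    have hom_k : hom_polyfun 1 (coord (vbasis {:V}) k).
      by apply: hom_polyfun_linear => a u w; rewrite linearP.
    exists (1%N, coord (vbasis {:V}) k : V -> K); split=> //=.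
    by exists p => //; move/(vanishes_atE hom_k pv)/eqP; rewrite (negPf vk).
  have [ci_closed [[q cq] _] _] := c_irr i (ltnW le_ie).
  have [_ /boolp.existsNP[p /boolp.not_implyP[cp ncp]]] := c_lt i le_ie.
  have [d [F [Fd F0 Fp]]] := zclosed_separation ci_closed ncp.
  exists (d, F); split=> //=; [|by exists p | by move=> k [<-]].
  (* A form of degree 0 is constant, and would be zero because it vanishes on the nonempty [c i].
     Positive degrees make the common degree [D] positive. *)
  rewrite lt0n; apply: contra_notN Fp => /eqP d0 v _.
  have Fcst u : F u = F 0.
    by rewrite -[in RHS](scale0r u) (hom_polyfun_homog _ _ Fd) d0 expr0 mul1r.
  by rewrite Fcst; apply: (F0 q cq); rewrite mem0v.
have [dF dFP] := boolp.choice sep.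
pose d i := (dF i).1; pose F i := (dF i).2.
pose D := (\prod_(i < e.+1) d i)%N.
have d_dvd i : (i <= e)%N -> (d i %| D)%N.
  by move=> le_ie; rewrite /D (bigD1 (Ordinal (_ : i < e.+1)%N)) //= dvdn_mulr.
have d_gt0 i : (i <= e)%N -> (0 < d i)%N by move=> /dFP[].
have D_gt0 : (0 < D)%N by apply: prodn_cond_gt0 => i _; rewrite d_gt0 // -ltnS.
have quo_gt0 i : (i <= e)%N -> (0 < D %/ d i)%N.
  by move=> le_ie; rewrite divn_gt0 ?d_gt0 // dvdn_leq ?d_dvd.
exists D, (fun i v => F i v ^+ (D %/ d i)); split=> i le_ie.
- have [_ Fi _ _] := dFP i le_ie.
  by rewrite -{1}(divnK (d_dvd i le_ie)) mulnC; apply: hom_polyfunX.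
- have [_ Fi [p cp Fp] _] := dFP i le_ie; exists p => // Fp0; apply: Fp => v pv.
  by have /eqP := Fp0 v pv; rewrite expf_eq0 => /andP[_ /eqP].
- move=> p cp v pv; have [_ _ _ F0] := dFP i.+1 le_ie.
  by rewrite /F (F0 i erefl p cp v pv) expr0n eqn0Ngt quo_gt0.
Qed.

Lemma linear_dependency (K : fieldType) (V : vectType K) m (x : 'I_m -> V) :
  (\dim {:V} < m)%N ->
  exists a : 'I_m -> K, (exists i, a i != 0) /\ \sum_i a i *: x i = 0.
Proof.
move=> lt_dim; apply: boolp.contrapT => no_a.
have free_x : free [tuple x i | i < m].
  apply/freeP => a; under eq_bigr do rewrite -tnth_nth tnth_mktuple.
  move=> ax i; apply/eqP; apply: contraT => nz_ai; case: no_a.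
  by exists a; split=> //; exists i.
have := dimvS (subvf <<[tuple x i | i < m]>>%VS); move/eqP: free_x => ->.
by rewrite size_tuple leqNgt lt_dim.
Qed.

(** * Symmetric matrices with zero diagonal *)

Section DiagonalFree.
Variable R : comNzRingType.
Implicit Types b : 'I_6 -> R.

(* Symmetric with zero diagonal, in coordinates for which b = (1, 0, ..., 0)
   gives a nonsingular matrix: the flag b_k = ... = b_5 = 0 then consists of
   subspaces that meet the nonsingular locus. *)
Definition hollow_mx b : 'M[R]_4 := \matrix_(i, j) (nth [::]
  [:: [:: 0; b 0; b 2; b 3];
      [:: b 0; 0; b 4; b 5];
      [:: b 2; b 4; 0; b 0 + b 1];
      [:: b 3; b 5; b 0 + b 1; 0]] i)`_j.

Definition hollow_coord (B : 'M[R]_4) (k : 'I_6) : R :=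
  [:: B 0 1; B 2 3 - B 0 1; B 0 2; B 0 3; B 1 2; B 1 3]`_k.

Lemma hollow_mx_sym b : (hollow_mx b)^T = hollow_mx b.
Proof.
by apply/matrixP => -[[|[|[|[|//]]]] ?] -[[|[|[|[|//]]]] ?]; rewrite !mxE.
Qed.

Lemma hollow_mx_diag b i : hollow_mx b i i = 0.
Proof. by rewrite mxE; case: i => -[|[|[|[|//]]]] ?. Qed.

Lemma hollow_mxK b : hollow_coord (hollow_mx b) =1 b.
Proof.
move=> [[|[|[|[|[|[|//]]]]]] ilt]; rewrite /hollow_coord !mxE /=;
  try by congr b; apply/val_inj.
by rewrite addrC addKr; congr b; apply/val_inj.
Qed.

Lemma hollow_coordK (B : 'M[R]_4) : B^T = B -> (forall i, B i i = 0) ->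
  hollow_mx (hollow_coord B) = B.
Proof.
move=> symB B0; have B' i j : B i j = B j i by rewrite -{1}symB mxE.
apply/matrixP => -[[|[|[|[|//]]]] ilt] -[[|[|[|[|//]]]] jlt];
  rewrite mxE /hollow_coord /=;
  rewrite ?[B 0 1 + _]addrC ?subrK;
  first [ symmetry; apply: etrans (B0 (Ordinal ilt)); congr (B _ _); exact/val_inj
        | by congr (B _ _); apply/val_inj
        | by rewrite B'; congr (B _ _); apply/val_inj ].
Qed.

Lemma eq_hollow_mx b b' : b =1 b' -> hollow_mx b = hollow_mx b'.
Proof. by move=> bb'; apply/matrixP => i j; rewrite !mxE !bb'. Qed.

(* The second factor is the adjugate of the first; p, q and r are the products of
   complementary entries above the diagonal. *)
Lemma mul_hollow_mx_adj b (a := b 0) (f := b 0 + b 1) (p := a * f) (q := b 2 * b 5)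
    (r := b 3 * b 4) :
  hollow_mx b *m \matrix_(i, j) (nth [::]
    [:: [:: b 4 * b 5 * f *+ 2; f * (p - q - r); b 5 * (q - p - r); b 4 * (r - p - q)];
        [:: f * (p - q - r); b 2 * b 3 * f *+ 2; b 3 * (r - p - q); b 2 * (q - p - r)];
        [:: b 5 * (q - p - r); b 3 * (r - p - q); a * b 3 * b 5 *+ 2; a * (p - q - r)];
        [:: b 4 * (r - p - q); b 2 * (q - p - r); a * (p - q - r); a * b 2 * b 4 *+ 2]]
     i)`_j = (p ^+ 2 + q ^+ 2 + r ^+ 2 - (p * q + q * r + p * r) *+ 2)%:M.
Proof.
apply/matrixP => i j; rewrite /p /q /r /a /f mxE !big_ord_recl big_ord0 !mxE /=.
by case: i j => [[|[|[|[|//]]]] ?] [[|[|[|[|//]]]] ?];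
  rewrite eqE /= ?mulr1n ?mulr0n; ring.
Qed.

End DiagonalFree.

Lemma dhomog_det (R : comNzRingType) n m e (A : 'M[{mpoly R[m]}]_n) :
  (forall i j, A i j \is e.-homog) -> \det A \is (e * n).-homog.
Proof.
move=> Ae; rewrite rpred_sum // => s _; rewrite mulr_sign.
have prod_e : \prod_i A i (s i) \is (e * n).-homog.
  have := dhomog_bigprod (index_enum 'I_n) (fun i => Ae i (s i)).
  by rewrite sum_nat_const card_ord mulnC.
by case: (odd_perm s); rewrite ?rpredN.
Qed.

(** * The space of quadrics and the adjugate parametrisation *)

Section QuadricSpace.
Variable K : numFieldType.
Implicit Types (A : 'M[K]_4) (q : dhomog 4 K 2).

Fact mulX_homog (i j : 'I_4) : ('X_i * 'X_j : {mpoly K[4]}) \is 2.-homog.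
Proof. by rewrite (@dhomogM _ _ _ 1 _ 1) // dhomogX /= mdeg1. Qed.

Definition dqform A : dhomog 4 K 2 :=
  \sum_i \sum_j A i j *: DHomog (mulX_homog i j).

Lemma val_dqform A : val (dqform A) = qform A.
Proof.
rewrite (raddf_sum (@mpoly_of_dhomog 4 K 2)); apply: eq_bigr => i _.
by rewrite (raddf_sum (@mpoly_of_dhomog 4 K 2)).
Qed.

Lemma dqformZ c A : dqform (c *: A) = c *: dqform A.
Proof.
rewrite scaler_sumr; apply: eq_bigr => i _; rewrite scaler_sumr.
by apply: eq_bigr => j _; rewrite mxE scalerA.
Qed.

(** Polarisation recovers the symmetric matrix linearly from the form, so the entries of its
    adjugate are cubic forms on the space of quadrics. *)
Definition polar_mx q : 'M[K]_4 := \matrix_(i, j) (2^-1 *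
  ((val q).@[(delta_mx 0 i + delta_mx 0 j : 'rV_4) 0] -
   (val q).@[(delta_mx 0 i : 'rV_4) 0] - (val q).@[(delta_mx 0 j : 'rV_4) 0])).

Lemma polar_mx_lin i j c q r :
  polar_mx (c *: q + r) i j = c * polar_mx q i j + polar_mx r i j.
Proof. by rewrite !mxE /= !mevalD !mevalZ; ring. Qed.

Lemma dqformK A : A^T = A -> polar_mx (dqform A) = A.
Proof.
move=> symA; apply/matrixP => i j; rewrite mxE val_dqform !meval_qform.
have entry (k l : 'I_4) : ((delta_mx 0 k : 'rV_4) *m A *m (delta_mx 0 l)^T) 0 0 = A k l.
  rewrite -rowE mxE (bigD1 l) //= big1 ?addr0 => [|j' jl].
    by rewrite !mxE !eqxx mulr1.
  by rewrite !mxE (negPf jl) andbF mulr0.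
have addE (M N : 'M[K]_1) : (M + N) 0 0 = M 0 0 + N 0 0 by rewrite mxE.
have Aji : A j i = A i j by rewrite -{1}symA mxE.
rewrite linearD /= !mulmxDl !mulmxDr !addE !entry Aji.
by field.
Qed.

Lemma dqform_neq0 A : A^T = A -> A != 0 -> dqform A != 0.
Proof.
move=> symA; apply: contra_neq => A0; rewrite -(dqformK symA) A0.
apply/matrixP => i j; have := polar_mx_lin i j (-1) 0 0.
by rewrite scaler0 addr0 mulN1r addNr => ->; rewrite mxE.
Qed.

Lemma hom_polyfunB (V : vectType K) d (F G : V -> K) :
  hom_polyfun d F -> hom_polyfun d G -> hom_polyfun d (fun v => F v - G v).
Proof.
move=> /hom_polyfunP[f fd Ff] /hom_polyfunP[g gd Gg]; apply/hom_polyfunP.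
by exists (f - g) => [|v]; rewrite ?rpredB // mevalB Ff Gg.
Qed.

Lemma hom_polyfun_adj (i j : 'I_4) :
  hom_polyfun 3 (fun q : dhomog 4 K 2 => (\adj (polar_mx q)) i j).
Proof.
have -> : (fun q : dhomog 4 K 2 => (\adj (polar_mx q)) i j) =
    fun q => (-1) ^+ (j + i) * \det (row' j (col' i (polar_mx q))).
  by apply/boolp.funext => q; rewrite mxE.
apply: hom_polyfunZ; apply: (@hom_polyfun_det _ _ 3 1) => k l.
apply: hom_polyfun_linear => c q r.
have minorE p : row' j (col' i (polar_mx p)) k l = polar_mx p (lift j k) (lift i l).
  by rewrite [LHS]mxE [LHS]mxE.
by rewrite !minorE polar_mx_lin.
Qed.

(** These cubic forms separate the members of the flag: at [hollow_quadric b], for a nonsingular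
    matrix, they return the coordinates of [b] up to a nonzero factor, a double adjugate being a
    multiple of the matrix. *)
Lemma hom_polyfun_hollow_coord k :
  hom_polyfun 3 (fun q : dhomog 4 K 2 => hollow_coord (\adj (polar_mx q)) k).
Proof.
rewrite /hollow_coord; case: k => -[|[|[|[|[|[|//]]]]]] klt /=;
  by [exact: hom_polyfun_adj | apply: hom_polyfunB; exact: hom_polyfun_adj].
Qed.

(** The adjugate replaces the inverse, to which it is proportional on nonsingular matrices, because
    its entries are polynomials in [b]. *)
Definition hollow_quadric (b : 'I_6 -> K) : dhomog 4 K 2 :=
  dqform (\adj (hollow_mx b)).

Lemma map_hollow_mx (R S : comNzRingType) (f : {rmorphism R -> S}) b :
  map_mx f (hollow_mx b) = hollow_mx (f \o b).
Proof.
by apply/matrixP => -[[|[|[|[|//]]]] ?] -[[|[|[|[|//]]]] ?];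
  rewrite !mxE /= ?rmorph0 ?rmorphD.
Qed.

(** The adjugate of the generic matrix has cubic entries, and the coordinates of the quadric are
    linear in them; substitution thus triples the degree. *)
Lemma hollow_pullback d (F : dhomog 4 K 2 -> K) : hom_polyfun d F ->
  exists2 G : {mpoly K[6]}, G \is (3 * d).-homog &
    forall b, F (hollow_quadric b) = G.@[b].
Proof.
move=> /hom_polyfunP[f fd Ff].
pose A := \adj (hollow_mx (fun i => 'X_i : {mpoly K[6]})).
have A_hom k l : A k l \is 3.-homog.
  rewrite /A mxE /cofactor -signr_odd mulr_sign.
  have : \det (row' l (col' k (hollow_mx (fun i => 'X_i : {mpoly K[6]}))))
      \is (1 * 3).-homog.
    apply: dhomog_det => i j; rewrite !mxE.
    have X_hom m : ('X_m : {mpoly K[6]}) \is 1.-homog by rewrite dhomogX /= mdeg1.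
    case: (lift l i) (lift k j) => [[|[|[|[|//]]]] ?] [[|[|[|[|//]]]] ?] /=;
    by rewrite ?rpred0 // ?rpredD.
  by rewrite mul1n; case: ifP; rewrite ?rpredN.
have AE b k l : (A k l).@[b] = (\adj (hollow_mx b)) k l.
  have <- : map_mx (meval b) (hollow_mx (fun i => 'X_i)) = hollow_mx b.
    by rewrite map_hollow_mx; apply: eq_hollow_mx => i /=; rewrite mevalXU.
  by rewrite -map_mx_adj [RHS]mxE.
pose x i k l : K := coord (vbasis {:dhomog 4 K 2}) i (DHomog (mulX_homog k l)).
pose lq := [tuple \sum_k \sum_l x i k l *: A k l | i < \dim {:dhomog 4 K 2}].
exists (f \mPo lq) => [|b].
  apply: dhomog_comp_mpoly => // i; rewrite tnth_mktuple.
  by rewrite rpred_sum // => k _; rewrite rpred_sum // => l _; rewrite rpredZ ?A_hom.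
rewrite Ff comp_mpoly_meval; apply: meval_eq => i; rewrite tnth_mktuple.
rewrite /hollow_quadric /dqform linear_sum raddf_sum; apply: eq_bigr => k _ /=.
rewrite linear_sum raddf_sum; apply: eq_bigr => l _ /=.
by rewrite linearZ /= mevalZ AE mulrC.
Qed.

Lemma hollow_mx_unit (b : 'I_6 -> K) : b 0 * (b 0 + b 1) != 0 ->
  b 2 * b 5 = 0 -> b 3 * b 4 = 0 -> hollow_mx b \in unitmx.
Proof.
move=> nz_p q0 r0; have /= := mul_hollow_mx_adj b; rewrite q0 r0.
rewrite expr0n !mul0r !mulr0 !addr0 mul0rn !subr0.
set p := b 0 * _ in nz_p *; set C := \matrix_(i, j) _ => BC.
apply: (@proj1 _ ((p ^+ 2)^-1 *: C \in unitmx)); apply: mulmx1_unit.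
by rewrite -scalemxAr BC scale_scalar_mx mulVf // expf_neq0.
Qed.

Lemma adj_hollow_sym (b : 'I_6 -> K) :
  (\adj (hollow_mx b))^T = \adj (hollow_mx b).
Proof. by rewrite trmx_adj hollow_mx_sym. Qed.

Lemma adj_unitmx n (A : 'M[K]_n) : A \in unitmx -> \adj A = \det A *: invmx A.
Proof.
move=> unitA; rewrite -[LHS](mulKmx unitA) mul_mx_adj -mul_scalar_mx.
by rewrite mul_mx_scalar mul_scalar_mx.
Qed.

(** Multiplying A adj(A) = det(A) I by the adjugate of adj(A) gives det(A) adj(adj(A)) = det(adj(A))
    A, where both determinants are nonzero. *)
Lemma adj_adj_unitmx n (A : 'M[K]_n) : A \in unitmx ->
  exists2 c, c != 0 & \adj (\adj A) = c *: A.
Proof.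
move=> unitA; have nz_d : \det A != 0 by rewrite -unitfE -unitmxE.
set B := \adj A.
have AB : A *m B = (\det A)%:M by exact: mul_mx_adj.
have nz_dB : \det B != 0.
  have := expf_neq0 n nz_d; rewrite -det_scalar -AB det_mulmx.
  by rewrite mulf_eq0 negb_or => /andP[].
have : A *m B *m \adj B = \det B *: A by rewrite -mulmxA mul_mx_adj mul_mx_scalar.
rewrite AB mul_scalar_mx => adjB; exists (\det B / \det A).
  by rewrite mulf_neq0 ?invr_eq0.
by rewrite mulrC -scalerA -adjB scalerA mulVf // scale1r.
Qed.

Lemma hollow_point (b : 'I_6 -> K) : hollow_mx b \in unitmx ->
  exists w : quadric K, val w = <[hollow_quadric b]>%VS.
Proof.
move=> unitb; apply: proj_point; apply: dqform_neq0 (adj_hollow_sym b) _.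
apply: contraTneq unitb => adj0; rewrite unitmxE unitfE negbK.
have := mul_mx_adj (hollow_mx b); rewrite adj0 mulmx0 => /matrixP/(_ 0 0).
by rewrite !mxE mulr1n => <-.
Qed.

End QuadricSpace.

Lemma meval_line (R : comNzRingType) n (G : {mpoly R[n]}) (b c : 'I_n -> R) :
  exists p : {poly R}, forall t, p.[t] = G.@[fun i => b i + t * (c i - b i)].
Proof.
elim/mpolyind: G => [|a m G _ _ [p pE]].
  by exists 0 => t; rewrite horner0 meval0.
exists (a *: \prod_i ((b i)%:P + (c i - b i) *: 'X) ^+ m i + p) => t.
rewrite hornerD hornerZ horner_prod pE mevalD mevalZ mevalX; congr (_ * _ + _).
apply: eq_bigr => i _.
by rewrite horner_exp hornerD hornerC hornerZ hornerX [in RHS]mulrC.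
Qed.

(** On the line through [b1] (at 0) and [b2] (at 1) both polynomials become nonzero univariate ones,
    and so does their product. The point found stays in every linear subspace containing [b1] and
    [b2]. *)
Lemma meval_line_neq0 (K : numDomainType) n (G1 G2 : {mpoly K[n]})
    (b1 b2 : 'I_n -> K) : G1.@[b1] != 0 -> G2.@[b2] != 0 ->
  exists t, (G1 * G2).@[fun i => b1 i + t * (b2 i - b1 i)] != 0.
Proof.
move=> G1b G2b; have [p1 p1E] := meval_line G1 b1 b2.
have [p2 p2E] := meval_line G2 b1 b2.
have nz_p1 : p1 != 0.
  apply: contraNneq G1b => p10; have := p1E 0; rewrite p10 horner0 => /esym/eqP.
  by rewrite (meval_eq (v2 := b1)) // => i; rewrite mul0r addr0.
have nz_p2 : p2 != 0.
  apply: contraNneq G2b => p20; have := p2E 1; rewrite p20 horner0 => /esym/eqP.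
  by rewrite (meval_eq (v2 := b2)) // => i; rewrite mul1r addrC subrK.
have [t pt] : exists t, (p1 * p2).[t] != 0.
  by apply: poly_neq0_horner; rewrite mulf_neq0.
by exists t; rewrite mevalM -p1E -p2E -hornerM.
Qed.

(** * A flag of irreducible closed sets *)

Section HollowQuadrics.
Variable K : numFieldType.
Implicit Types (b : 'I_6 -> K) (w : quadric K).

(** The closures of these sets form the chain of length 5; at [k = 5] no coordinate is
    constrained. *)
Definition hollow_quadrics (k : nat) : set (quadric K) :=
  [set w | exists b, [/\ forall j : 'I_6, (k < j)%N -> b j = 0,
     hollow_mx b \in unitmx & val w = <[hollow_quadric b]>%VS]].

Lemma hollow_quadricsS k : hollow_quadrics k `<=` hollow_quadrics k.+1.
Proof.
by move=> w [b [b0 unitb wb]]; exists b; split=> // j /ltnW; apply: b0.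
Qed.

(** With B = A^-1, the adjugate of B is det(B) A, which defines the same quadric as A. *)
Lemma zero_diag_hollow : zero_diag_inverse_quadrics K = hollow_quadrics 5.
Proof.
apply/seteqP; split=> w.
  move=> [A] [symA unitA A0 [q [wq qA]]].
  have BE : hollow_mx (hollow_coord (invmx A)) = invmx A.
    by rewrite hollow_coordK // trmx_inv symA.
  have qE : q = dqform A.
    apply/val_inj; rewrite val_dqform; apply: mpoly_eq_rV => x.
    by rewrite meval_qform -qA.
  exists (hollow_coord (invmx A)); split; rewrite ?BE ?unitmx_inv //.
    by move=> j; rewrite ltnNge -ltnS ltn_ord.
  rewrite /hollow_quadric BE adj_unitmx ?unitmx_inv // invmxK dqformZ wq qE.
  by rewrite vlineZ // -unitfE -unitmxE unitmx_inv.
move=> [b [_ unitb wb]]; exists (invmx (hollow_mx b)).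
split; first by rewrite trmx_inv hollow_mx_sym.
- by rewrite unitmx_inv.
- by move=> i; rewrite invmxK hollow_mx_diag.
exists (dqform (invmx (hollow_mx b))); split.
  rewrite wb /hollow_quadric adj_unitmx // dqformZ vlineZ //.
  by rewrite -unitfE -unitmxE.
by move=> x; rewrite /mpoly_fun val_dqform meval_qform.
Qed.

(** A nonsingular member of the flag with nonzero coordinate [k]: in the notation of
    [mul_hollow_mx_adj], coordinate 0 keeps [p] nonzero, and a single further coordinate leaves [q]
    and [r] zero. *)
Definition flag_point (k : 'I_6) (j : 'I_6) : K := ((j == 0) || (j == k))%:R.

Lemma flag_point_unit k : hollow_mx (flag_point k) \in unitmx.
Proof.
apply: hollow_mx_unit; rewrite /flag_point; case: k => -[|[|[|[|[|[|//]]]]]] ?;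
  rewrite -!(inj_eq val_inj) /= ?mulr0 ?mul0r // ?addr0 ?mul1r ?oner_eq0 //.
(* The case [k = 1], where [b 0 + b 1] is 2. *)
by rewrite -(natrD _ 1 1) pnatr_eq0.
Qed.

(** If neither closed set contains the closure, each is killed by a form that is nonzero at some
    parameter. On the line joining the two parameters, some point avoids the zeros of both forms,
    hence both closed sets. *)
Lemma zirreducible_hollow k : zirreducible (zclosure (hollow_quadrics k)).
Proof.
split.
  have [w wb] := hollow_point (flag_point_unit 0).
  exists w; apply: sub_zclosure; exists (flag_point 0); split=> //.
    by move=> j kj; rewrite /flag_point orbb -val_eqE /= gtn_eqF // (leq_ltn_trans _ kj).
  exact: flag_point_unit.
move=> Z1 Z2 Z1c Z2c Z12; apply: boolp.contrapT => /boolp.not_orP[nZ1 nZ2].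
have sep Z : zclosed Z -> ~ zclosure (hollow_quadrics k) `<=` Z ->
    exists d F b, [/\ hom_polyfun d F, forall w, Z w -> vanishes_at F w,
      F (hollow_quadric b) != 0 &
      (forall j : 'I_6, (k < j)%N -> b j = 0) /\ hollow_mx b \in unitmx].
  move=> Zc nZ; have [w [b [b0 unitb wb]] nZw] : exists2 w, hollow_quadrics k w & ~ Z w.
    apply: boolp.contrapT => no_w; apply: nZ; apply: zclosure_min => // w kw.
    by apply: boolp.contrapT => nZw; apply: no_w; exists w.
  have [d [F [Fd FZ Fw]]] := zclosed_separation Zc nZw.
  exists d, F, b; split=> //; apply/eqP => Fb; apply: Fw.
  exact/(vanishes_atE Fd wb).
have [d1 [F1 [b1 [F1d F1Z F1b [b10 unitb1]]]]] := sep _ Z1c nZ1.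
have [d2 [F2 [b2 [F2d F2Z F2b [b20 unitb2]]]]] := sep _ Z2c nZ2.
have [G1 _ G1E] := hollow_pullback F1d; have [G2 _ G2E] := hollow_pullback F2d.
pose Gdet : {mpoly K[6]} := \det (hollow_mx (fun i => 'X_i)).
have GdetE b : Gdet.@[b] = \det (hollow_mx b).
  rewrite -det_map_mx map_hollow_mx; congr (\det _).
  by apply: eq_hollow_mx => i /=; rewrite mevalXU.
(* The determinant factor makes the point found nonsingular, so that it belongs to the family. *)
have [||t] := @meval_line_neq0 _ _ (G1 * Gdet) G2 b1 b2.
- by rewrite mevalM -G1E GdetE mulf_neq0 // -unitfE -unitmxE.
- by rewrite -G2E.
set b := fun i => _; rewrite !mevalM -G1E -G2E GdetE !mulf_eq0 !negb_or.
move=> /andP[/andP[F1t dett] F2t].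
have unitb : hollow_mx b \in unitmx by rewrite unitmxE unitfE.
have [w wb] := hollow_point unitb.
have [|/F1Z/(vanishes_atE F1d wb)/eqP|/F2Z/(vanishes_atE F2d wb)/eqP] := Z12 w.
- apply: sub_zclosure; exists b; split=> // j kj.
  by rewrite /b b10 // b20 // subrr mulr0 addr0.
- by rewrite (negPf F1t).
- by rewrite (negPf F2t).
Qed.

Lemma hollow_coord_quadric b (k : 'I_6) : hollow_mx b \in unitmx ->
  exists2 c, c != 0 &
    hollow_coord (\adj (polar_mx (hollow_quadric b))) k = c * b k.
Proof.
move=> unitb; have [c nz_c cE] := adj_adj_unitmx unitb; exists c => //.
rewrite dqformK ?adj_hollow_sym // cE -(hollow_mxK b k) /hollow_coord.
set B := hollow_mx b; have scE i j : (c *: B) i j = c * B i j by rewrite mxE.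
by case: k => -[|[|[|[|[|[|//]]]]]] ? /=; rewrite !scE ?mulrBr.
Qed.

(** The cubic form reading off coordinate [k.+1] vanishes on the smaller closure, but not at the
    quadric of [flag_point j]. *)
Lemma hollow_flag_lt k : (k < 5)%N ->
  zclosure (hollow_quadrics k) `<` zclosure (hollow_quadrics k.+1).
Proof.
move=> lt_k5; split; first exact: zclosure_mono (@hollow_quadricsS k).
move=> sub; pose j : 'I_6 := Ordinal (lt_k5 : (k.+1 < 6)%N).
have F_hom := hom_polyfun_hollow_coord K j.
have [w wb] := hollow_point (flag_point_unit j).
have : vanishes_at (fun q : dhomog 4 K 2 => hollow_coord (\adj (polar_mx q)) j) w.
  apply: (zclosure_vanishes F_hom) (sub w _) => [v [b [b0 unitb vb]]|].
    apply/(vanishes_atE F_hom vb); have [c _ ->] := hollow_coord_quadric j unitb.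
    by rewrite b0 ?mulr0.
  apply: sub_zclosure; exists (flag_point j); split=> // [i ki|].
    by rewrite /flag_point -!val_eqE /= !gtn_eqF // (leq_ltn_trans _ ki).
  exact: flag_point_unit.
move=> /(vanishes_atE F_hom wb).
have [c nz_c ->] := hollow_coord_quadric j (flag_point_unit j).
by move/eqP; rewrite /flag_point eqxx orbT mulr1 (negPf nz_c).
Qed.

Lemma hollow_flag :
  irr_chain (zclosure (hollow_quadrics 5)) 5 (fun k => zclosure (hollow_quadrics k)).
Proof.
split=> [i le_i5|i]; last exact: hollow_flag_lt.
split; [exact: zclosed_zclosure | exact: zirreducible_hollow |].
rewrite -(subnK le_i5); elim: (5 - i)%N => [|m IHm] //.
rewrite addSn; apply: subset_trans IHm (zclosure_mono (@hollow_quadricsS _)).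
Qed.

End HollowQuadrics.

(** * The upper bound on the dimension *)

Lemma leq_ffact_exp n m : (n ^_ m <= n ^ m)%N.
Proof.
elim: m n => [|m IHm] n; first by rewrite ffactn0.
rewrite ffactnS expnS leq_mul2l; apply/orP; right.
apply: leq_trans (IHm _) _; case: m {IHm} => // m.
by rewrite leq_exp2r // leq_pred.
Qed.

(** The left side is the dimension of the forms of degree T = 18 D N in 6 variables. It is at most
    (T + 5)^5, hence at most ((18 D + 5) N)^5, which the choice of [N] turns into N^6. *)
Lemma bin_lt_exp D (N := ((18 * D + 5) ^ 5)%N) :
  ('C(3 * D * (6 * N) + 5, 3 * D * (6 * N)) < N.+1 ^ 6)%N.
Proof.
set T := (3 * D * (6 * N))%N.
have N_gt0 : (0 < N)%N by rewrite expn_gt0 addn_gt0 orbT.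
have le_T : (T + 5 <= (18 * D + 5) * N)%N.
  rewrite mulnDl leq_add //; last by rewrite leq_pmulr.
  by rewrite /T mulnCA mulnA mulnA.
rewrite -bin_sub ?leq_addr // addKn.
apply: (@leq_ltn_trans ((T + 5) ^_ 5)%N).
  by rewrite -bin_ffact leq_pmulr // fact_gt0.
apply: leq_ltn_trans (leq_ffact_exp _ _) _.
apply: (@leq_ltn_trans (((18 * D + 5) * N) ^ 5)%N); first by rewrite leq_exp2r.
rewrite expnMn -/N -expnS ltn_exp2r //.
Qed.

Lemma hollow_dim_le (K : numFieldType) e (c : nat -> set (quadric K)) :
  irr_chain (zclosure (@hollow_quadrics K 5)) e c -> (e <= 5)%N.
Proof.
move=> chain; rewrite leqNgt; apply/negP => lt_5e.
have [D [f [f_hom f_neq0 f_eq0]]] := irr_chain_forms chain.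
have le_e (i : 'I_7) : (i <= e)%N by apply: leq_trans lt_5e; rewrite -ltnS.
have /boolp.choice[G GP] (i : 'I_7) : exists G : {mpoly K[6]},
    G \is (3 * D).-homog /\ forall b, f i (hollow_quadric b) = G.@[b].
  by have [G G1 G2] := hollow_pullback (f_hom i (le_e i)); exists G.
pose N := ((18 * D + 5) ^ 5)%N.
pose J : finType := {ffun 'I_6 -> 'I_N.+1}.
(* The exponents of [f 1], ..., [f 6] range freely over 0, ..., N, and that of [f 0] completes the
   total degree to 6 N. *)
pose ex (j : J) (i : nat) : nat :=
  if i is i'.+1 then j (inord i') else (6 * N - \sum_(k < 6) j k)%N.
have ex_sum j : (\sum_(i < 7) ex j i = 6 * N)%N.
  rewrite big_ord_recl (eq_bigr (fun k => nat_of_ord (j k))) => [|k _]; last first.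
    by rewrite lift0 /= inord_val.
  rewrite {1}/ex /= subnK //; have -> : (6 * N = \sum_(k < 6) N)%N.
    by rewrite sum_nat_const card_ord.
  by apply: leq_sum => k _; rewrite -ltnS.
have ex_inj j j' : (forall i, (i <= 6)%N -> ex j i = ex j' i) -> j = j'.
  move=> jj'; apply/ffunP => k; apply/val_inj.
  by have := jj' k.+1 (ltn_ord k); rewrite /= inord_val.
pose T := (3 * D * (6 * N))%N.
have P_hom j : \prod_(i < 7) G i ^+ ex j i \is T.-homog.
  rewrite /T -(ex_sum j) big_distrr /=; apply: dhomog_bigprod => i.
  by apply: dhomogMn; case: (GP i).
pose x (m : 'I_#|J|) : dhomog 6 K T := DHomog (P_hom (enum_val m)).
(* There are (N + 1)^6 pulled back monomials, more than the dimension of the space containing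
   them. *)
have [|a [[m0 am0] ax]] := linear_dependency x.
  by rewrite dimvf card_ffun !card_ord; exact: bin_lt_exp.
have [c_irr c_lt] := chain.
have c_sub i : (i < e)%N -> c i `<=` c i.+1 by move=> /c_lt[].
have c_irr' i : (i <= e)%N -> zirreducible (c i) by move=> /c_irr[].
apply: (@chain_independent _ _ e D c f c_irr' c_sub f_hom f_neq0 f_eq0 _
  (fun m => ex (enum_val m)) a 6 [pred m | a m != 0] (6 * N)%N) => //.
- by exists m0.
- by move=> m m' _ _ /ex_inj/enum_val_inj.
have F_hom : hom_polyfun (D * (6 * N)) (fun v : dhomog 4 K 2 =>
    \sum_(m | a m != 0) a m * chain_monomial f 6 (ex (enum_val m)) v).
  apply: hom_polyfun_sum => m _; apply: hom_polyfunZ.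
  by rewrite -(ex_sum (enum_val m)); apply: (chain_monomial_homog f_hom).
(* As [c 6] lies in the closure, the relation need only be checked on the family itself, where it
   pulls back to the linear dependency. *)
have [_ _ c6H] := c_irr 6%N lt_5e; move=> p /c6H.
apply: (zclosure_vanishes F_hom) => w [b [_ _ wb]]; apply/(vanishes_atE F_hom wb).
have axb : \sum_m a m * (\prod_(i < 7) G i ^+ ex (enum_val m) i).@[b] = 0.
  have := congr1 (fun q : dhomog 6 K T => (mpoly_of_dhomog q).@[b]) ax.
  rewrite (raddf_sum (@mpoly_of_dhomog 6 K T)) raddf_sum meval0 => ax0; rewrite -[RHS]ax0.
  have axE m : a m * (\prod_(i < 7) G i ^+ ex (enum_val m) i).@[b] =
      (mpoly_of_dhomog (a m *: x m)).@[b] by rewrite /= mevalZ.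
  by rewrite (eq_bigr _ (fun m _ => axE m)).
rewrite -[RHS]axb [RHS](bigID (fun m => a m != 0)) /= [X in _ + X]big1 ?addr0.
  apply: eq_bigr => m _; congr (_ * _); rewrite rmorph_prod.
  by apply: eq_bigr => i _; rewrite rmorphXn /=; case: (GP i) => _ ->.
by move=> m /negPn/eqP->; rewrite mul0r.
Qed.

Theorem theorem1p1 (R : realType) :
  let H : set (quadric R[i]) := zclosure (hadamard_quadrics R[i]) in
  zdim_eq H 5 /\ H = zclosure (zero_diag_inverse_quadrics R[i]).
Proof.
rewrite /= hadamard_quadricsE; split=> //; rewrite zero_diag_hollow.
split; last exact: hollow_dim_le.
by exists (fun k => zclosure (@hollow_quadrics R[i] k)); exact: hollow_flag.
Qed.
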